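(* Fix $p\ge2$ and consider the $p$-spin Curie–Weiss model, i.e. the $p$-tensor Ising model with $J_{i_1\dots i_p}=N^{1-p}$ for all $1\le i_1,\dots,i_p\le N$. Let $g(t)=\beta t^p-I(t)$ on $[-1,1]$. Then for every $\beta>\beta^*_{\mathrm{CW}}(p)$, $g$ has a unique positive global maximizer $m_*=m_*(\beta,p)$ and, as $N\to\infty$, $\sqrt N(\hat\beta_N(\bm X)-\beta)\to N\big(0,-\frac{g''(m_* )}{p^2m_*^{2p-2}}\big)$ in distribution, where $\bm X\sim\mathbb P_\beta$.
   Context: With $J_{i_1\dots i_p}=N^{1-p}$, the model is $\mathbb P_\beta(\bm X)\propto e^{\beta H_N(\bm X)}$ on $\{-1,1\}^N$ with $H_N(\bm X)=\sum_{i_1,\dots,i_p}J_{i_1\dots i_p}X_{i_1}\cdots X_{i_p}=N\bar X_N^p$, $\bar X_N=N^{-1}\sum_iX_i$. With $m_i(\bm X)=\sum_{i_2,\dots,i_p}J_{ii_2\dots i_p}X_{i_2}\cdots X_{i_p}$, the MPL estimate is $\hat\beta_N(\bm X)=\inf\{b\ge0:H_N(\bm X)=\sum_im_i(\bm X)\tanh(pb\,m_i(\bm X))\}$ (inf of empty set $=+\infty$). $I(t)=\frac12[(1+t)\log(1+t)+(1-t)\log(1-t)]$ and $\beta^*_{\mathrm{CW}}(p)=\sup\{\beta\ge0:\sup_{t\in[0,1]}(\beta t^p-I(t))=0\}$. *)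

(* Defs.v *)
From HB Require Import structures.
From mathcomp Require Import all_boot all_order all_algebra.
From mathcomp Require Import all_classical all_reals all_analysis.
Set Implicit Arguments. Unset Strict Implicit. Unset Printing Implicit Defensive.
Import Order.TTheory GRing.Theory Num.Theory.
Import numFieldNormedType.Exports.
Local Open Scope classical_set_scope.
Local Open Scope ring_scope.

Section PspinCW.
Variable R : realType.

Definition tanh (x : R) : R := (expR x - expR (- x)) / (expR x + expR (- x)).

Definition spin (b : bool) : R := if b then 1 else -1.

Definition config (N : nat) := {ffun 'I_N -> bool}.

Definition Jcw (N p : nat) : R := (N%:R ^+ p.-1)^-1.

Definition Ham (N p : nat) (x : config N) : R :=
  \sum_(iota : {ffun 'I_p -> 'I_N}) Jcw N p * \prod_(k < p) spin (x (iota k)).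

Definition mloc (N p : nat) (x : config N) (i : 'I_N) : R :=
  \sum_(iota : {ffun 'I_p.-1 -> 'I_N}) Jcw N p * \prod_(k < p.-1) spin (x (iota k)).

(* MPL estimate: inf { b >= 0 : H_N = sum_i m_i tanh(p b m_i) }, inf of empty set = +oo *)
Definition mpl (N p : nat) (x : config N) : \bar R :=
  ereal_inf [set b%:E | b in [set b : R | 0 <= b /\
     Ham p x = \sum_(i < N) mloc p x i * tanh (p%:R * b * mloc p x i)]].

Definition gibbs_weight (N p : nat) (beta : R) (x : config N) : R :=
  expR (beta * Ham p x).
Definition gibbs_prob (N p : nat) (beta : R) (A : pred (config N)) : R :=
  (\sum_(x : config N | A x) gibbs_weight p beta x) /
  (\sum_(x : config N) gibbs_weight p beta x).

Definition Ient (t : R) : R :=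
  ((1 + t) * ln (1 + t) + (1 - t) * ln (1 - t)) / 2.

Definition gfun (beta : R) (p : nat) (t : R) : R := beta * t ^+ p - Ient t.

Definition betaCW (p : nat) : \bar R :=
  ereal_sup [set b%:E | b in [set b : R | 0 <= b /\
     ereal_sup [set (gfun b p t)%:E | t in `[0, 1]] = 0%E]].

Definition pos_global_max (beta : R) (p : nat) (m : R) : Prop :=
  0 < m /\ m \in `[-1, 1] /\ forall t, t \in `[-1, 1] -> gfun beta p t <= gfun beta p m.

(* CDF of N(0, v); for v <= 0 the degenerate law at 0 (point mass) *)
Definition normal_cdf (v : R) (t : R) : R :=
  if 0 < v then fine (normal_prob 0 (Num.sqrt v) `]-oo, t])
  else (if 0 <= t then 1 else 0).

Definition cvg_in_dist_gibbs (p : nat) (beta : R)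
    (Y : forall N : nat, config N -> \bar R) (F : R -> R) : Prop :=
  forall t : R, {for t, continuous F} ->
    (fun N : nat => gibbs_prob p beta (fun x => (Y N x <= t%:E)%E)) @ \oo --> F t.

End PspinCW.

(* Main.v *)
Require Import Defs.
From HB Require Import structures.
From mathcomp Require Import all_boot all_order all_algebra.
From mathcomp Require Import all_classical all_reals all_analysis.
From mathcomp Require Import measurable_realfun ring lra.
Import Order.TTheory GRing.Theory Num.Theory.
Import numFieldNormedType.Exports.
Local Open Scope classical_set_scope.
Local Open Scope ring_scope.
Set Implicit Arguments. Unset Strict Implicit. Unset Printing Implicit Defensive.

(** The Hamiltonian and the local fields depend on a configuration only through its
magnetization [x], so wherever [0 < x < 1] the pseudolikelihood equation reads
[x = tanh (p * b * x ^ (p - 1))] and the estimate is [phi x = atanh x / (p * x ^ (p - 1))].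
Since [phi m = beta] and [phi' m = - g'' m / (p * m ^ (p - 1))] at the maximizer [m] of [g],
the theorem reduces by the delta method to a central limit theorem for the magnetization.

The lattice point [x_k = 2 k / N - 1] has weight ['C(N, k) * exp (beta * N * x_k ^ p)
= 2 ^ N * exp (N * g x_k) * rho N k], where [rho N k = s N / (s k * s (N - k))] and
[s n = n! * e ^ n / n ^ n].  As [s n] is nondecreasing and [s n / n] nonincreasing, [rho] is
polynomially bounded, and its ratio at two lattice points tends to [1] when both tend to [m];
no Stirling constant is needed because it cancels in the normalization.  Near [m] the weights
form a step function of the rescaled magnetization, dominated by a Gaussian and converging
pointwise to one, so dominated convergence gives the limit.  Away from [m] (and from [-m],
which contributes symmetrically when [p] is even) the weights are exponentially small.

The maximizer is nondegenerate and unique because [t I''(t) / I'(t)] increases: this gives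
[t I' / I <= 1 + t I'' / I'], which with [g m > 0] and [g' m = 0] yields [g'' m < 0] and
makes [phi] increasing to the right of [m]. *)

(** * Entropy and the variational problem *)

Section Calculus.
Context {R : realType}.
Implicit Types (a b c t x y m : R).

Lemma MVT_closed (f df : R -> R) a b : a < b ->
  (forall x, a <= x <= b -> is_derive x 1 f (df x)) ->
  exists2 c, a < c < b & f b - f a = df c * (b - a).
Proof.
move=> ab fd.
have [||c cab e] := @MVT R f df a b ab.
- by move=> x; rewrite in_itv/= => /andP[ax xb]; apply: fd; rewrite !ltW.
- apply: derivable_within_continuous => x; rewrite in_itv/= => xab.
  by have [] := fd _ xab.
- by move: cab; rewrite in_itv/=; exists c.
Qed.

Lemma derive_ge0_le (f df : R -> R) a b : a <= b ->
  (forall x, a <= x <= b -> is_derive x 1 f (df x)) ->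
  (forall x, a < x < b -> 0 <= df x) -> f a <= f b.
Proof.
rewrite le_eqVlt => /orP[/eqP-> //|ab] fd df0.
have [c cab e] := MVT_closed ab fd.
by rewrite -subr_ge0 e mulr_ge0 ?df0 // subr_ge0 ltW.
Qed.

Lemma derive_gt0_lt (f df : R -> R) a b : a < b ->
  (forall x, a <= x <= b -> is_derive x 1 f (df x)) ->
  (forall x, a < x < b -> 0 < df x) -> f a < f b.
Proof.
move=> ab fd df0.
have [c cab e] := MVT_closed ab fd.
by rewrite -subr_gt0 e mulr_gt0 ?df0 // subr_gt0.
Qed.

(** Written with logarithms because this is the derivative of [Ient]; on the open interval from -1
    to 1 it inverts [tanh]. *)
Definition atanh t : R := (ln (1 + t) - ln (1 - t)) / 2.

Lemma is_derive_ln1D t : -1 < t -> is_derive t 1 (fun x => ln (1 + x)) (1 + t)^-1.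
Proof.
move=> t1.
have h : 0 < 1 + t by lra.
have d := is_derive1_ln h.
have e : is_derive t (1:R) (fun x : R => 1 + x) 1.
  by apply: is_derive_eq; rewrite add0r mul1r.
have := @is_derive1_comp R (@ln R) (fun x => 1 + x) t _ _ d e.
by rewrite mulr1.
Qed.

Lemma is_derive_ln1B t : t < 1 -> is_derive t 1 (fun x => ln (1 - x)) (- (1 - t)^-1).
Proof.
move=> t1.
have h : 0 < 1 - t by lra.
have d := is_derive1_ln h.
have e : is_derive t (1:R) (fun x : R => 1 - x) (-1).
  by apply: is_derive_eq; rewrite add0r mul1r.
have := @is_derive1_comp R (@ln R) (fun x => 1 - x) t _ _ d e.
by rewrite mulrN1.
Qed.

Lemma is_derive_atanh t : -1 < t < 1 -> is_derive t 1 atanh (1 - t ^+ 2)^-1.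
Proof.
move=> /andP[t0 t1].
have d1 := is_derive_ln1D t0; have d2 := is_derive_ln1B t1.
rewrite /atanh.
apply: is_derive_eq.
rewrite /GRing.scale/=.
field; apply/and3P; split; apply/negP => /eqP; nra.
Qed.

Lemma is_derive_Ient t : -1 < t < 1 -> is_derive t 1 (@Ient R) (atanh t).
Proof.
move=> /andP[t0 t1].
have d1 := is_derive_ln1D t0; have d2 := is_derive_ln1B t1.
rewrite /Ient.
apply: is_derive_eq.
rewrite /GRing.scale/= /atanh.
field; apply/andP; split; apply/negP => /eqP; nra.
Qed.

Lemma atanh0 : atanh 0 = 0.
Proof. by rewrite /atanh addr0 subr0 subrr mul0r. Qed.

Lemma Ient0 : Ient (0:R) = 0.
Proof. by rewrite /Ient addr0 subr0 ln1 !mulr0 addr0 mul0r. Qed.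

Lemma IentN t : Ient (- t) = Ient t.
Proof. by rewrite /Ient opprK addrC. Qed.

Lemma atanh_gt0 t : 0 < t < 1 -> 0 < atanh t.
Proof.
move=> /andP[t0 t1]; rewrite /atanh divr_gt0// subr_gt0 ltr_ln ?posrE; lra.
Qed.

Lemma atanh_ge_id t : 0 <= t < 1 -> t <= atanh t.
Proof.
move=> /andP[t0 t1].
have := @derive_ge0_le (fun x => atanh x - x) (fun x => (1 - x ^+ 2)^-1 - 1) 0 t t0.
rewrite atanh0 !subr0 subr_ge0; apply => x /andP[x0 xt].
  by have d : is_derive x 1 atanh _ := @is_derive_atanh x ltac:(lra); apply: is_derive_eq.
rewrite subr_ge0 invf_ge1; nra.
Qed.

(* By [ln z <= z - 1] rather than convexity, so that the endpoints [-1] and [1] are covered. *)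
Lemma Ient_tangent c t : -1 < c < 1 -> -1 <= t <= 1 ->
  Ient c + atanh c * (t - c) <= Ient t.
Proof.
move=> /andP[c0 c1] /andP[t0 t1].
have key (y d : R) : 0 <= y -> 0 < d -> y * ln d + y - d <= y * ln y.
  rewrite le_eqVlt => /orP[/eqP <-|y0] d0; first by lra.
  have dy : 0 < d / y by rewrite divr_gt0.
  have := @le_ln1Dx R (d / y - 1) ltac:(lra).
  rewrite addrC subrK ln_div ?posrE // => h.
  have : y * (ln d - ln y) <= y * (d / y - 1) by rewrite ler_pM2l.
  have -> : y * (d / y - 1) = d - y by field; lra.
  lra.
have k1 := key (1 + t) (1 + c) ltac:(lra) ltac:(lra).
have k2 := key (1 - t) (1 - c) ltac:(lra) ltac:(lra).
rewrite /Ient /atanh; lra.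
Qed.

Lemma Ient_ge0 t : -1 <= t <= 1 -> 0 <= Ient t.
Proof.
move=> ht; have := @Ient_tangent 0 t ltac:(lra) ht.
by rewrite atanh0 Ient0 mul0r addr0.
Qed.

Lemma Ient_gt0 t : 0 < t < 1 -> 0 < Ient t.
Proof.
move=> ht.
have h := @Ient_tangent (t/2) t ltac:(lra) ltac:(lra).
have h2 := @Ient_ge0 (t/2) ltac:(lra).
have h3 := @atanh_gt0 (t/2) ltac:(lra).
have : 0 < atanh (t / 2) * (t - t / 2) by rewrite mulr_gt0//; lra.
lra.
Qed.

Lemma is_derive_exprn (n : nat) (t : R) :
  is_derive t 1 (fun x : R => x ^+ n) (n%:R * t ^+ n.-1).
Proof.
have := @is_deriveX R _ id n t 1 1 (is_derive_id _ _).
by rewrite exprfctE /GRing.scale/= mulr1.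
Qed.

(** Covers both expansions needed: order [j = 1] for [phi], and order [j = 2] for [g] at a critical
    point. [taylor_scaled] then serves both. *)
Definition little_o_at (f : R -> R) (m l : R) (j : nat) := forall e, 0 < e ->
  exists2 d, 0 < d &
    forall h, `|h| <= d -> `|f (m + h) - f m - l * h ^+ j| <= e * `|h| ^+ j.

Lemma is_derive_approx (f : R -> R) x l : is_derive x 1 f l -> little_o_at f x l 1.
Proof.
move=> [/derivable_nbhs + <-] e e0; rewrite /=.
move=> /eqaddoP /(_ e e0) /nbhs_ballP[d /= d0 hd].
exists (d / 2) => [|h hh]; first by rewrite divr_gt0.
have := hd h; rewrite -ball_normE /= sub0r normrN.
move=> H.
rewrite (_ : f (x + h) - f x - 'D_1 f x * h = f (h%:A + x) - (f x + h *: 'D_1 f x)); last first.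
  by rewrite opprD addrA [h%:A]mulr1 (addrC h) (mulrC ('D_1 f x)).
by apply: H; rewrite (le_lt_trans hh)// ltr_pdivrMr//; lra.
Qed.

Lemma tanh_itv y : -1 < tanh y < 1.
Proof.
have := expR_gt0 y; have := expR_gt0 (- y); rewrite /tanh => a0 b0.
by rewrite ltr_pdivlMr ?ltr_pdivrMr ?addr_gt0//; lra.
Qed.

Lemma tanhK : cancel (@tanh R) atanh.
Proof.
move=> y; have := expR_gt0 y; have := expR_gt0 (- y) => a0 b0.
have s0 : expR y + expR (- y) != 0 by rewrite gt_eqF ?addr_gt0.
rewrite /atanh -ln_div ?posrE; last 2 first.
- by have := tanh_itv y; lra.
- by have := tanh_itv y; lra.
rewrite (_ : (1 + _) / _ = expR (y + y)); last first.
  rewrite expRD /tanh; have := expRxMexpNx_1 y.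
  move: (expR y) (expR (- y)) a0 b0 s0 => a b a0 b0 s0 ab.
  have bn : b != 0 by rewrite gt_eqF.
  have -> : a * a = a / b by apply: (mulIf bn); rewrite divfK // -mulrA ab mulr1.
  by field; rewrite bn s0 /= gt_eqF //; lra.
by rewrite expRK; field.
Qed.

Lemma atanh_lt x y : -1 < x -> x < y -> y < 1 -> atanh x < atanh y.
Proof.
move=> x1 xy y1; apply: (derive_gt0_lt (df := fun t => (1 - t ^+ 2)^-1) xy) => t tx.
  by apply: is_derive_atanh; lra.
by rewrite invr_gt0; nra.
Qed.

Lemma atanh_inj x y : -1 < x < 1 -> -1 < y < 1 -> atanh x = atanh y -> x = y.
Proof.
move=> /andP[x0 x1] /andP[y0 y1] e; case: (ltgtP x y) => // xy.
- by have := atanh_lt x0 xy y1; rewrite e ltxx.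
- by have := atanh_lt y0 xy x1; rewrite e ltxx.
Qed.

Lemma atanhK x : -1 < x < 1 -> tanh (atanh x) = x.
Proof. by move=> hx; apply: atanh_inj => //; [exact: tanh_itv|exact: tanhK]. Qed.

Lemma is_derive_atanh_ratio x : 0 < x < 1 ->
  is_derive x 1 (fun t => - ((1 - t ^+ 2) * atanh t / t))
    (((1 + x ^+ 2) * atanh x - x) / x ^+ 2).
Proof.
move=> hx; have x0 : x != 0 by rewrite gt_eqF //; lra.
have d := @is_derive_atanh x ltac:(lra).
have dv : is_derive x 1 (fun t => t^-1) (- x ^- 2 *: 1) := is_deriveV x0 (is_derive_id x 1).
have dq : is_derive x 1 (fun t => 1 - t ^+ 2) (- (2 * x)).
  by apply: is_derive_eq; rewrite /GRing.scale/=; ring.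
apply: (is_derive_eq (is_deriveN (is_deriveM (is_deriveM dq d) dv))).
rewrite /GRing.scale/= mulrfctE; field.
by rewrite x0/= gt_eqF //; nra.
Qed.

(** The ratio is [I' / (t I'')]. Its derivative has the sign of [x - (1 + x ^+ 2) * atanh x],
    nonpositive because [x <= atanh x]. *)
Lemma atanh_ratio_le (s t : R) : 0 < s -> s <= t -> t < 1 ->
  (1 - t ^+ 2) * atanh t / t <= (1 - s ^+ 2) * atanh s / s.
Proof.
move=> s0 st t1; rewrite -lerN2.
apply: (@derive_ge0_le (fun t => - ((1 - t ^+ 2) * atanh t / t))
  (fun x => ((1 + x ^+ 2) * atanh x - x) / x ^+ 2) _ _ st) => [x hx|x hx].
  by apply: is_derive_atanh_ratio; lra.
have := @atanh_ge_id x ltac:(lra) => ha.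
rewrite divr_ge0 ?sqr_ge0// subr_ge0 (le_trans ha)// ler_peMl; nra.
Qed.

(* [t I'(t) / I(t) <= 1 + t I''(t) / I'(t)], with [I' = atanh]; [M] is the inverse of [t I'' / I']. *)
Lemma Ient_atanh_le m (M := (1 - m ^+ 2) * atanh m / m) : 0 < m < 1 ->
  M * (m * atanh m) <= (1 + M) * Ient m.
Proof.
move=> /andP[m0 m1]; rewrite -subr_ge0.
(* [f] vanishes at 0, and [f' x >= 0] says that [M] is at most the ratio at [x], which holds for
   [x < m] by [atanh_ratio_le]. *)
pose f x := (1 + M) * Ient x - M * (x * atanh x).
have <- : f 0 = 0 by rewrite /f Ient0 !(mul0r,mulr0) subr0.
apply: (derive_ge0_le (df := fun x => atanh x - M * (x / (1 - x ^+ 2))) (ltW m0)) => x /andP[x0 xm].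
  have d := @is_derive_atanh x ltac:(lra).
  have d2 := @is_derive_Ient x ltac:(lra).
  have d3 := is_deriveM (is_derive_id x 1) d.
  apply: (is_derive_eq (is_deriveB (is_deriveZ (1 + M) d2) (is_deriveZ M d3))).
  rewrite /GRing.scale/=; field.
  by rewrite gt_eqF //; nra.
have := atanh_ratio_le x0 (ltW xm) m1; rewrite -/M => h.
have q0 : 0 < 1 - x ^+ 2 by nra.
rewrite subr_ge0 mulrA ler_pdivrMr//.
by move: h; rewrite ler_pdivlMr// mulrC (mulrC (atanh x)).
Qed.

(** * The variational function: maximizer, nondegeneracy and the inverse map [phi] *)

Section gfun.
Variables (p : nat) (beta : R).
Hypothesis p2 : (2 <= p)%N.
Hypothesis beta0 : 0 <= beta.

Let g := gfun beta p.
Definition gfun' t : R := beta * (p%:R * t ^+ p.-1) - atanh t.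
Definition gfun'' t : R := beta * (p%:R * (p.-1%:R * t ^+ p.-2)) - (1 - t ^+ 2)^-1.

Lemma is_derive_gfun t : -1 < t < 1 -> is_derive t 1 g (gfun' t).
Proof.
move=> ht; have d := is_derive_Ient ht.
exact: (is_deriveB (is_deriveZ beta (is_derive_exprn p t)) d).
Qed.

Lemma is_derive_gfun' t : -1 < t < 1 -> is_derive t 1 gfun' (gfun'' t).
Proof.
move=> ht; have d := is_derive_atanh ht.
exact: (is_deriveB (is_deriveZ beta (is_deriveZ p%:R (is_derive_exprn p.-1 t))) d).
Qed.

Lemma gfun0 : g 0 = 0.
Proof. by rewrite /g /gfun Ient0 expr0n; case: p p2 => //= n _; rewrite mulr0 subr0. Qed.

(** Since [Ient] is even and [t ^+ p <= |t| ^+ p], maximizing over [[-1, 1]] reduces to [[0, 1]]. *)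
Lemma gfun_le_norm t : g t <= g `|t|.
Proof.
rewrite /g /gfun lerB ?ler_wpM2l//; first by rewrite -normrX ler_norm.
by case: (ger0P t) => _ //; rewrite IentN.
Qed.

Lemma derive1_derive1_gfun t : -1 < t < 1 -> derive1 (derive1 g) t = gfun'' t.
Proof.
move=> ht; have [_ <-] := is_derive_gfun' ht.
rewrite derive1E; apply: near_eq_derive.
have : t \in `]-1, 1[ by rewrite in_itv.
move=> /near_in_itvoo; apply: filterS => x; rewrite in_itv /= => hx.
by have [_ <-] := is_derive_gfun hx; rewrite derive1E.
Qed.

(** The slope [atanh] of the entropy is unbounded near 1 while that of [beta * t ^+ p] is at most
    [beta * p]. This keeps maxima away from 1, where [g] is not differentiable, and reduces them to
    compact subintervals. *)
Lemma gfun_tail c : 0 <= c < 1 -> exists2 b, c < b < 1 & forall t, b < t <= 1 -> g t < g b.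
Proof.
(* The point sought is [tanh y]: the first bound makes the entropy slope there exceed [beta * p],
   the second puts it beyond [c]. *)
move=> hc; pose y := Num.max (beta * p%:R + 1) (atanh c + 1).
have [y1 y2] : beta * p%:R + 1 <= y /\ atanh c + 1 <= y by rewrite /y !le_max !lexx ?orbT.
have hb := tanh_itv y.
have cb : c < tanh y.
  rewrite ltNge; apply/negP => bc.
  have : atanh (tanh y) <= atanh c.
    move: bc; rewrite le_eqVlt => /orP[/eqP -> //|bc].
    by apply/ltW/atanh_lt; lra.
  by rewrite tanhK; lra.
exists (tanh y) => [|t ht]; first by lra.
have := @Ient_tangent (tanh y) t hb ltac:(lra); rewrite tanhK => h1.
have h2 : t ^+ p - tanh y ^+ p <= p%:R * (t - tanh y).
  have := @derive_ge0_le (fun x => p%:R * x - x ^+ p) (fun x => p%:R * 1 - p%:R * x ^+ p.-1)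
    (tanh y) t ltac:(lra).
  move=> H.
  have : p%:R * tanh y - tanh y ^+ p <= p%:R * t - t ^+ p.
    apply: H => x hx.
      exact: (is_deriveB (is_deriveZ p%:R (is_derive_id x 1)) (is_derive_exprn p x)).
    by rewrite subr_ge0 ler_wpM2l// exprn_ile1//; lra.
  by rewrite mulrBr; lra.
have h3 : beta * (t ^+ p - tanh y ^+ p) < y * (t - tanh y).
  apply: (@le_lt_trans _ _ (beta * (p%:R * (t - tanh y)))); first by rewrite ler_wpM2l.
  by rewrite mulrA ltr_pM2r// ?subr_gt0; lra.
rewrite /g /gfun; move: h3; rewrite mulrBr; lra.
Qed.

Lemma gfun_within_cont a b : -1 < a -> b < 1 -> {within `[a, b], continuous g}.
Proof.
move=> a1 b1; apply: derivable_within_continuous => x; rewrite in_itv/= => xab.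
by have [] := @is_derive_gfun x ltac:(lra).
Qed.

Lemma gfun_taylor m : -1 < m < 1 -> gfun' m = 0 ->
  little_o_at g m (gfun'' m / 2) 2.
Proof.
move=> hm g'0 e e0.
have [d d0 hd] := is_derive_approx (is_derive_gfun' hm) e0.
(* The last two bounds keep the window around [m] inside the open interval where [g] is
   differentiable. *)
pose d' := Num.min d (Num.min ((1 - m) / 2) ((1 + m) / 2)).
have [dd d1 d2] : [/\ d' <= d, d' <= (1 - m) / 2 & d' <= (1 + m) / 2].
  by split; rewrite /d' !ge_min lexx ?orbT.
have d'0 : 0 < d' by rewrite !lt_min d0 !divr_gt0//; lra.
exists d' => // h hh; rewrite real_normK ?num_real//.
have hh2 : - d' <= h <= d' by rewrite -ler_norml.
(* With the quadratic term removed, the derivative of [G] is the first-order remainder of [gfun'],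
   so the mean value theorem bounds the increment of [G]. *)
pose G x := g x - gfun'' m / 2 * (x - m) ^+ 2.
have dG x : m - d' <= x <= m + d' -> is_derive x 1 G (gfun' x - gfun'' m * (x - m)).
  move=> hx; have dg := @is_derive_gfun x ltac:(lra).
  have dq : is_derive x 1 (fun x => (x - m) ^+ 2) (2 * (x - m)).
    by apply: is_derive_eq; rewrite /GRing.scale/=; ring.
  apply: (is_derive_eq (is_deriveB dg (is_deriveZ (gfun'' m / 2) dq))).
  by rewrite /GRing.scale/=; field.
have -> : g (m + h) - g m - gfun'' m / 2 * h ^+ 2 = G (m + h) - G m.
  rewrite /G subrr (addrC m h) addrK; ring.
have bnd c : `|c - m| <= `|h| -> `|(gfun' c - gfun'' m * (c - m)) * h| <= e * h ^+ 2.
  move=> hc; have := hd (c - m) (le_trans hc (le_trans hh dd)).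
  rewrite (addrC m) subrK g'0 subr0 normrM => H.
  apply: (@le_trans _ _ ((e * `|c - m|) * `|h|)); first by rewrite ler_wpM2r.
  by rewrite -mulrA ler_wpM2l ?(ltW e0)// -real_normK ?num_real// expr2 ler_wpM2r.
case: (ltgtP h 0) => [h0|h0|->].
- have [|x hx|c hc E] := @MVT_closed G (fun x => gfun' x - gfun'' m * (x - m)) (m + h) m.
  + lra.
  + by apply: dG; lra.
  + rewrite distrC E (_ : m - (m + h) = - h); last ring.
    by rewrite mulrN normrN bnd// !ltr0_norm//; lra.
- have [|x hx|c hc E] := @MVT_closed G (fun x => gfun' x - gfun'' m * (x - m)) m (m + h).
  + lra.
  + by apply: dG; lra.
  + rewrite E (_ : (m + h) - m = h); last ring.
    by rewrite bnd// !gtr0_norm//; lra.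
- by rewrite addr0 subrr normr0 expr0n/= mulr0.
Qed.

(** This is [g'' m < 0] in disguise. The critical equation turns [g m > 0] into
    [p * I m < m * I' m]; with [Ient_atanh_le] this gives [p * M < 1 + M]. *)
Lemma atanh_ratio_lt m : 0 < m < 1 -> gfun' m = 0 -> 0 < g m ->
  (1 - m ^+ 2) * atanh m / m * p.-1%:R < 1.
Proof.
move=> hm g'0 gm.
have I0 := Ient_gt0 hm.
have := Ient_atanh_le hm; set M := _ / m => HM.
have M0 : 0 < M.
  apply: divr_gt0; last by lra.
  by apply: mulr_gt0; [nra|exact: atanh_gt0].
have pS : p = p.-1.+1 by case: p p2.
have pI : p%:R * Ient m < m * atanh m.
  have -> : atanh m = beta * (p%:R * m ^+ p.-1) by move: g'0; rewrite /gfun'; lra.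
  move: gm; rewrite /g /gfun subr_gt0 => gm.
  have -> : m * (beta * (p%:R * m ^+ p.-1)) = p%:R * (beta * m ^+ p) 
    by rewrite (_ : m ^+ p = m * m ^+ p.-1); [ring|rewrite -exprS -pS].
  by rewrite ltr_pM2l// ltr0n; case: p p2.
have : M * (p%:R * Ient m) < (1 + M) * Ient m by rewrite (lt_le_trans _ HM)// ltr_pM2l.
rewrite mulrA ltr_pM2r// {1}pS -addn1 natrD; lra.
Qed.

Lemma gfun''_lt0 m : 0 < m < 1 -> gfun' m = 0 -> 0 < g m -> gfun'' m < 0.
Proof.
move=> hm g'0 gm; have := atanh_ratio_lt hm g'0 gm.
have -> : atanh m = beta * (p%:R * m ^+ p.-1) by move: g'0; rewrite /gfun'; lra.
have -> : m ^+ p.-1 = m * m ^+ p.-2 by rewrite -exprS; case: p p2 => [|[|]].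
rewrite /gfun'' subr_lt0 => h.
have q0 : 0 < 1 - m ^+ 2 by nra.
rewrite -[X in _ < X]mul1r ltr_pdivlMr//; move: h; congr (_ < 1).
by field; rewrite gt_eqF//; lra.
Qed.

Definition phi t := atanh t / (p%:R * t ^+ p.-1).

Lemma is_derive_phi t : 0 < t < 1 ->
  is_derive t 1 phi (((1 - t ^+ 2)^-1 - p.-1%:R * atanh t / t) / (p%:R * t ^+ p.-1)).
Proof.
move=> ht.
have p0 : p%:R != 0 :> R by rewrite pnatr_eq0; case: p p2.
have t0 : t != 0 by rewrite gt_eqF//; lra.
have d := @is_derive_atanh t ltac:(lra).
have d1 := is_deriveZ p%:R (is_derive_exprn p.-1 t).
have n0 : p%:R *: t ^+ p.-1 != 0 by rewrite mulf_neq0// expf_neq0.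
have dv := @is_deriveV R _ t _ 1 n0 d1.
apply: (is_derive_eq (is_deriveM d dv)).
rewrite /GRing.scale/= /GRing.scale/=.
have : p.-1%:R * t ^+ p.-1.-1 = p.-1%:R * (t ^+ p.-1 / t).
  case: p p2 => [|[|n]]//= _; congr (_ * _).
  by rewrite exprS mulrC mulKf.
move=> ->.
have q0 : 1 - t ^+ 2 != 0 by rewrite gt_eqF//; nra.
have tp : t ^+ p.-1 != 0 by rewrite expf_neq0.
by move: (t ^+ p.-1) tp => w w0; field; rewrite w0 t0 q0 p0.
Qed.

(** [phi'] is positive exactly when [p - 1] times the ratio of [atanh_ratio_le] is below 1. This
    holds at [m] and persists to its right because the ratio decreases. *)
Lemma phi_lt m t : 0 < m -> m < t -> t < 1 -> gfun' m = 0 -> 0 < g m -> phi m < phi t.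
Proof.
move=> m0 mt t1 g'0 gm.
have hr := @atanh_ratio_lt m ltac:(lra) g'0 gm.
apply: (derive_gt0_lt mt (fun x hx => @is_derive_phi x _)) => x hx; first by lra.
have x0 : 0 < x by lra.
have q0 : 0 < 1 - x ^+ 2 by nra.
rewrite divr_gt0//; last by rewrite mulr_gt0 ?exprn_gt0// ltr0n; case: p p2.
rewrite subr_gt0 -[X in _ < X]mul1r ltr_pdivlMr//.
have := @atanh_ratio_le m x m0 ltac:(lra) ltac:(lra) => h.
apply: le_lt_trans hr.
apply: le_trans (ler_wpM2r _ h) => //.
by rewrite le_eqVlt; apply/orP; left; apply/eqP; field; rewrite gt_eqF.
Qed.

Lemma phi_critical m : 0 < m -> gfun' m = 0 -> phi m = beta.
Proof.
move=> m0 g'0; rewrite /phi.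
have -> : atanh m = beta * (p%:R * m ^+ p.-1) by move: g'0; rewrite /gfun'; lra.
by rewrite mulfK// mulf_neq0 ?expf_neq0 ?gt_eqF// ltr0n; case: p p2.
Qed.

Lemma is_derive_phi_critical m : 0 < m < 1 -> gfun' m = 0 ->
  is_derive m 1 phi (- gfun'' m / (p%:R * m ^+ p.-1)).
Proof.
move=> hm g'0; apply: (is_derive_eq (is_derive_phi hm)); congr (_ / _).
rewrite /gfun'' opprB; congr (_ - _).
have -> : atanh m = beta * (p%:R * m ^+ p.-1) by move: g'0; rewrite /gfun'; lra.
have -> : m ^+ p.-1 = m * m ^+ p.-2 by rewrite -exprS; case: p p2 => [|[|]].
by field; rewrite gt_eqF//; lra.
Qed.

Lemma gfun'_max m : 0 < m < 1 -> (forall t, 0 <= t <= 1 -> g t <= g m) -> gfun' m = 0.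
Proof.
move=> hm gm; have hm' : m \in `]0, 1[ by rewrite in_itv.
have [|||_ <-] := @derive1_at_max R g 0 1 m _ _ hm' _.
- by [].
- by move=> t; rewrite in_itv/= => ht; have [] := @is_derive_gfun t ltac:(lra).
- by move=> t; rewrite in_itv/= => ht; apply: gm; lra.
- by have [_ <-] := @is_derive_gfun m ltac:(lra).
Qed.

Lemma gfun_max_lt1 m : 0 < g m -> 0 <= m <= 1 -> (forall t, 0 <= t <= 1 -> g t <= g m) -> 0 < m < 1.
Proof.
move=> gm hm mmax; apply/andP; split; rewrite lt_neqAle; apply/andP; split; try lra; apply/eqP => e.
  by move: gm; rewrite -e gfun0 ltxx.
have [b hb hb2] := @gfun_tail 0 ltac:(lra).
have := hb2 m ltac:(lra); have := mmax b ltac:(lra).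
by rewrite leNgt => /negbTE ->.
Qed.

(** Both maximizers are critical, so [phi] equals [beta] at each, whereas [phi] is strictly larger
    to the right of the smaller one. *)
Lemma gfun_max_unique m m' : 0 < g m -> 0 < m < 1 -> 0 <= m' <= 1 ->
  (forall t, 0 <= t <= 1 -> g t <= g m) -> g m' = g m -> m' = m.
Proof.
move=> gm hm hm' mmax gE.
have m'max t : 0 <= t <= 1 -> g t <= g m' by rewrite gE; exact: mmax.
have gm' : 0 < g m' by rewrite gE.
have {}hm' := gfun_max_lt1 gm' hm' m'max.
have d1 := gfun'_max hm mmax; have d2 := gfun'_max hm' m'max.
have e1 := @phi_critical m ltac:(lra) d1; have e2 := @phi_critical m' ltac:(lra) d2.
case: (ltgtP m m') => // lt.
- by have := @phi_lt m m' ltac:(lra) lt ltac:(lra) d1 gm; rewrite e1 e2 ltxx.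
- by have := @phi_lt m' m ltac:(lra) lt ltac:(lra) d2 gm'; rewrite e1 e2 ltxx.
Qed.

Lemma gfun_max_exists t1 : 0 <= t1 <= 1 -> 0 < g t1 ->
  exists m, [/\ 0 < m < 1, 0 < g m & forall t, -1 <= t <= 1 -> g t <= g m].
Proof.
move=> ht1 gt1.
have [b hb hb2] := @gfun_tail 0 ltac:(lra).
have [m] := @EVT_max R g 0 b ltac:(lra) (@gfun_within_cont 0 b ltac:(lra) ltac:(lra)).
rewrite in_itv/= => hm mmax.
have mx t : 0 <= t <= 1 -> g t <= g m.
  move=> ht; case: (leP t b) => tb; first by apply: mmax; rewrite in_itv/=; lra.
  apply: (@le_trans _ _ (g b)); first by apply/ltW/hb2; lra.
  by apply: mmax; rewrite in_itv/=; lra.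
have gm : 0 < g m by apply: lt_le_trans gt1 _; apply: mx.
exists m; split => //; first by apply: gfun_max_lt1 => //; lra.
move=> t ht; apply: le_trans (gfun_le_norm t) _; apply: mx.
by rewrite normr_ge0 ler_norml.
Qed.

Lemma gfun_sep_itv m a b : 0 < m < 1 -> 0 < g m -> (forall t, 0 <= t <= 1 -> g t <= g m) ->
  0 <= a -> b < 1 -> ~~ (a <= m <= b) ->
  exists2 e, 0 < e & forall t, a <= t <= b -> g t <= g m - e.
Proof.
move=> hm gm mmax a0 b1 nm.
case: (leP a b) => ab; last by exists 1 => // t ht; lra.
have [c] := EVT_max ab (@gfun_within_cont a b ltac:(lra) ltac:(lra)).
rewrite in_itv/= => hc cmax.
exists (g m - g c); last by move=> t ht; rewrite subKr; apply: cmax; rewrite in_itv.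
rewrite subr_gt0 lt_neqAle mmax ?andbT; last by lra.
by apply/eqP => /gfun_max_unique e; move: nm; rewrite -e ?hc//; lra.
Qed.

(** Compactness and uniqueness give a gap on either side of [m] up to some [b < 1]; beyond [b] the
    values stay below [g b] by [gfun_tail]. *)
Lemma gfun_separation m d : 0 < m < 1 -> 0 < g m -> (forall t, 0 <= t <= 1 -> g t <= g m) ->
  0 < d -> exists2 e, 0 < e & forall t, 0 <= t <= 1 -> d < `|t - m| -> g t <= g m - e.
Proof.
move=> hm gm mmax d0.
(* Shrinking [d] ensures [m + d' < 1], as [gfun_tail] requires. *)
pose d' := Num.min d ((1 - m) / 2).
have [d'0 d1 d2] : [/\ 0 < d', d' <= d & d' <= (1 - m) / 2].
  by split; rewrite /d' ?lt_min ?ge_min ?lexx ?orbT ?d0 ?divr_gt0//; lra.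
have [b hb hb2] := @gfun_tail (m + d') ltac:(lra).
have [e1 e10 he1] := @gfun_sep_itv m 0 (m - d') hm gm mmax ltac:(lra) ltac:(lra) ltac:(lra).
have [e2 e20 he2] := @gfun_sep_itv m (m + d') b hm gm mmax ltac:(lra) ltac:(lra) ltac:(lra).
exists (Num.min e1 e2); first by rewrite lt_min e10.
have [m1 m2] : Num.min e1 e2 <= e1 /\ Num.min e1 e2 <= e2 by rewrite !ge_min !lexx orbT.
move=> t ht; rewrite lter_normr => /orP[] dt; last first.
  by have := he1 t ltac:(lra); lra.
case: (leP t b) => tb; first by have := he2 t ltac:(lra); lra.
by have := hb2 t ltac:(lra); have := he2 b ltac:(lra); lra.
Qed.

End gfun.

(** The supremum of [g] is at least [g 0 = 0]. Were no value positive, [beta] would lie in the set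
    defining [betaCW]; and 0 lies in that set, whence [0 <= beta]. *)
Lemma betaCW_lt p beta : (2 <= p)%N -> (betaCW R p < beta%:E)%E ->
  0 <= beta /\ exists2 t, 0 <= t <= 1 & 0 < gfun beta p t.
Proof.
move=> p2; rewrite /betaCW => hlt.
have sup_ge0 b : (0 <= ereal_sup [set (gfun b p t)%:E | t in `[0%R, 1%R]%classic])%E.
  by apply: ereal_sup_ubound; exists 0; rewrite ?gfun0//= in_itv/= lexx ler01.
have b0 : 0 <= beta.
  rewrite -lee_fin; apply: le_trans (ltW hlt); apply: ereal_sup_ubound.
  exists 0 => //; split => //; apply/eqP; rewrite eq_le sup_ge0 andbT.
  apply: ge_ereal_sup => _ [t /= + <-]; rewrite in_itv/= => ht.
  by rewrite lee_fin /gfun mul0r sub0r oppr_le0 Ient_ge0//; lra.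
split => //; apply: contrapT => hn.
move: hlt; rewrite ltNge => /negP; apply; apply: ereal_sup_ubound.
exists beta => //; split => //; apply/eqP; rewrite eq_le sup_ge0 andbT.
apply: ge_ereal_sup => _ [t /= + <-]; rewrite in_itv/= => ht.
rewrite lee_fin leNgt; apply/negP => gt; apply: hn; by exists t.
Qed.

End Calculus.

(** * Stirling ratios and binomial coefficients *)

Section Stirling.
Context {R : realType}.
Implicit Types (n k N : nat).

(** The convention [0 ^+ 0 = 1] gives [stir 0 = 1], so the extreme lattice points [k = 0] and
    [k = N] need no separate treatment. *)
Definition stir n : R := n`!%:R * expR n%:R / n%:R ^+ n.

Lemma stir0 : stir 0 = 1.
Proof. by rewrite /stir fact0 expR0 expr0 mulr1 divr1. Qed.

Lemma exprnn_gt0 n : 0 < n%:R ^+ n :> R.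
Proof. by case: n => [|n]; rewrite ?expr0// exprn_gt0// ltr0n. Qed.

Lemma stir_gt0 n : 0 < stir n.
Proof. by rewrite /stir divr_gt0 ?exprnn_gt0// mulr_gt0 ?expR_gt0// ltr0n fact_gt0. Qed.

Lemma stirS n : stir n.+1 = stir n * (expR 1 * (n%:R / n.+1%:R) ^+ n).
Proof.
rewrite /stir factS natrM -(addn1 n) natrD expRD exprD expr1 expr_div_n.
have := exprnn_gt0 n => /lt0r_neq0; move: (n%:R ^+ n) => w w0.
have h : (n%:R + 1 : R) != 0 by rewrite gt_eqF// ltr_wpDl.
have := expf_neq0 n h; move: ((n%:R + 1) ^+ n) => v v0.
by field; rewrite h v0 w0.
Qed.

(** For positive [n] this is [(1 + 1/n)^n <= e]. *)
Lemma stir_leS n : stir n <= stir n.+1.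
Proof.
rewrite stirS ler_peMr ?(ltW (stir_gt0 n))//.
case: n => [|n]; first by rewrite expr0 mulr1 -expR0 ler_expR.
have n0 : 0 < n.+1%:R :> R by rewrite ltr0n.
have -> : n.+1%:R / n.+2%:R = (1 + n.+1%:R^-1)^-1 :> R.
  rewrite -[n.+2]addn1 natrD; field; rewrite !gt_eqF//; lra.
have q0 : 0 < 1 + n.+1%:R^-1 :> R by rewrite addr_gt0// invr_gt0.
rewrite exprVn ler_pdivlMr ?mul1r ?exprn_gt0//.
rewrite (_ : expR 1 = expR (n.+1%:R^-1) ^+ n.+1); last first.
  by rewrite -expRM_natl divff// gt_eqF.
by rewrite ler_pXn2r ?expR_ge1Dx// nnegrE ?expR_ge0// addr_ge0// invr_ge0 ltW.
Qed.

Lemma stir_le n k : (n <= k)%N -> stir n <= stir k.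
Proof. by apply: (@homo_leq _ stir (fun x y => x <= y)) => [x|y x z|j] //; [exact: le_trans|exact: stir_leS]. Qed.

Lemma stir_ge1 n : 1 <= stir n.
Proof. by rewrite -stir0 stir_le. Qed.

(** Equivalent to [(1 - 1/(n+2))^(n+2) <= 1/e], an instance of [1 + x <= expR x]. *)
Lemma stir_divS n : stir n.+2 / n.+2%:R <= stir n.+1 / n.+1%:R.
Proof.
have n0 : 0 < n.+1%:R :> R by rewrite ltr0n.
have n1 : 0 < n.+2%:R :> R by rewrite ltr0n.
rewrite stirS -mulrA ler_pM2l ?stir_gt0// ler_pdivrMr// ler_pdivlMl// mulrCA.
have -> : n.+1%:R * (n.+1%:R / n.+2%:R) ^+ n.+1 = n.+2%:R * (n.+1%:R / n.+2%:R) ^+ n.+2 :> R.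
  by rewrite [in RHS]exprS; field; rewrite !gt_eqF.
rewrite mulrCA ler_piMr ?(ltW n1)// mulrC -ler_pdivlMr ?expR_gt0// mul1r -expRN.
have -> : -1 = n.+2%:R * (- n.+2%:R^-1) :> R by field; rewrite gt_eqF.
rewrite expRM_natl ler_pXn2r ?nnegrE ?expR_ge0 ?divr_ge0//.
apply: le_trans (expR_ge1Dx _); rewrite le_eqVlt; apply/orP; left; apply/eqP.
by rewrite -[n.+2]addn1 natrD; field; rewrite gt_eqF//; lra.
Qed.

Lemma stir_div_le n k : (0 < n)%N -> (n <= k)%N -> stir k / k%:R <= stir n / n%:R.
Proof.
case: n k => [|n] [|k] // _; rewrite ltnS.
move: n k; apply: (@homo_leq _ (fun n => stir n.+1 / n.+1%:R) (fun x y => y <= x)) => [x|y x z xy yz|n].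
- exact: lexx.
- exact: le_trans yz xy.
- exact: stir_divS.
Qed.

Lemma stir_ub n : (0 < n)%N -> stir n <= expR 1 * n%:R.
Proof.
move=> n0; rewrite -ler_pdivrMr ?ltr0n//; apply: le_trans (stir_div_le _ n0) _ => //.
by rewrite /stir (_ : 1`! = 1)%N // mul1r expr1 !divr1.
Qed.

(** The two monotonicities squeeze the ratio between 1 and [n / k], so it tends to 1 whenever
    [n / k] does; this stands in for Stirling's formula. *)
Lemma stir_ratio_bounds n k : (0 < n)%N -> (0 < k)%N ->
  Num.min 1 (n%:R / k%:R) <= stir n / stir k <= Num.max 1 (n%:R / k%:R).
Proof.
move=> n0 k0.
have [nk|/ltnW kn] := leqP n k.
- have h : stir n / stir k <= 1 by rewrite ler_pdivrMr ?stir_gt0// mul1r stir_le.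
  rewrite le_max h/= andbT ge_min; apply/orP; right.
  rewrite ler_pdivrMr ?ltr0n// mulrAC ler_pdivlMr ?stir_gt0//.
  have := stir_div_le n0 nk.
  by rewrite ler_pdivrMr ?ltr0n// mulrAC ler_pdivlMr ?ltr0n// mulrC.
- have h : 1 <= stir n / stir k by rewrite ler_pdivlMr ?stir_gt0// mul1r stir_le.
  rewrite ge_min h/= le_max; apply/orP; right.
  rewrite ler_pdivlMr ?ltr0n// mulrAC ler_pdivrMr ?stir_gt0//.
  have := stir_div_le k0 kn.
  by rewrite ler_pdivrMr ?ltr0n// mulrAC ler_pdivlMr ?ltr0n// [X in _ <= X]mulrC.
Qed.

(* The non-exponential factor of ['C(N, k)], see [bin_magn]. *)
Definition rho N k : R := stir N / (stir k * stir (N - k)).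

Definition magn N k : R := 2 * k%:R / N%:R - 1.

Lemma rho_gt0 N k : 0 < rho N k.
Proof. by apply: divr_gt0; [|apply: mulr_gt0]; exact: stir_gt0. Qed.

Lemma rho_sub N k : (k <= N)%N -> rho N (N - k) = rho N k.
Proof. by move=> kN; rewrite /rho subKn// (mulrC (stir k)). Qed.

Lemma magn_sub N k : (k <= N)%N -> (0 < N)%N -> magn N (N - k) = - magn N k.
Proof.
move=> kN N0; rewrite /magn natrB//; field.
by rewrite pnatr_eq0 -lt0n.
Qed.

Lemma magn_itv N k : (k <= N)%N -> (0 < N)%N -> -1 <= magn N k <= 1.
Proof.
move=> kN N0; have n0 : 0 < N%:R :> R by rewrite ltr0n.
have : k%:R <= N%:R :> R by rewrite ler_nat.
have : 0 <= k%:R :> R by [].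
have -> : k%:R = (magn N k + 1) / 2 * N%:R :> R by rewrite /magn; field; rewrite gt_eqF.
move=> h1 h2; rewrite pmulr_lge0// in h1.
by rewrite ger_pMl// in h2; lra.
Qed.

Lemma rho_le N k : (0 < N)%N -> rho N k <= expR 1 * N%:R.
Proof.
move=> N0; apply: le_trans (stir_ub N0).
have s0 : 0 < stir k * stir (N - k) by apply: mulr_gt0; exact: stir_gt0.
rewrite /rho ler_pdivrMr// ler_peMr ?(ltW (stir_gt0 N))//.
by rewrite -[1]mulr1 ler_pM ?stir_ge1.
Qed.

Lemma rho_inv_le N k : (0 < N)%N -> (k <= N)%N -> (rho N k)^-1 <= (expR 1 * N%:R) ^+ 2.
Proof.
move=> N0 kN; rewrite /rho invf_div ler_pdivrMr ?stir_gt0//.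
apply: (@le_trans _ _ ((expR 1 * N%:R) ^+ 2)); last first.
  by rewrite ler_peMr ?stir_ge1// exprn_ge0// mulr_ge0// expR_ge0.
rewrite expr2; apply: ler_pM; rewrite ?(ltW (stir_gt0 _))//; apply: le_trans (stir_ub N0); apply: stir_le => //.
exact: leq_subr.
Qed.

(** Allows [y = 0] when [n = 0], which occurs in the entropy at the magnetizations -1 and 1. *)
Lemma expR_mul_ln (y : R) n : 0 <= y -> (n != 0%N -> 0 < y) -> expR (n%:R * ln y) = y ^+ n.
Proof.
move=> y0 yn; case: n yn => [|n] yn; first by rewrite mul0r expR0 expr0.
by rewrite expRM_natl lnK// posrE yn.
Qed.

(** An exact identity: the exponential of the entropy produces the powers [k ^+ k],
    [(N - k) ^+ (N - k)] and [N ^+ N] that turn factorials into [stir]. *)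
Lemma bin_magn N k : (0 < N)%N -> (k <= N)%N ->
  'C(N, k)%:R * expR (N%:R * Ient (magn N k)) = 2 ^+ N * rho N k.
Proof.
move=> N0 kN; have n0 : 0 < N%:R :> R by rewrite ltr0n.
have nn0 : N%:R != 0 :> R by rewrite gt_eqF.
have -> : N%:R * Ient (magn N k) = k%:R * ln (2 * k%:R / N%:R) + (N - k)%:R * ln (2 * (N - k)%:R / N%:R).
  rewrite /Ient (_ : 1 + magn N k = 2 * k%:R / N%:R); last by rewrite /magn; ring.
  rewrite (_ : 1 - magn N k = 2 * (N - k)%:R / N%:R); last by rewrite /magn natrB//; field.
  by field.
rewrite expRD.
have pos j : j != 0%N -> 0 < 2 * j%:R / N%:R :> R.
  by rewrite -lt0n => j0; rewrite divr_gt0// mulr_gt0// ltr0n.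
rewrite !expR_mul_ln ?divr_ge0 ?mulr_ge0//; [|exact: pos|exact: pos].
have := bin_fact kN => /(congr1 (fun n => n%:R : R)); rewrite !natrM => bf.
have fk : k`!%:R != 0 :> R by rewrite pnatr_eq0 -lt0n fact_gt0.
have fnk : (N - k)`!%:R != 0 :> R by rewrite pnatr_eq0 -lt0n fact_gt0.
have -> : 'C(N, k)%:R = N`!%:R / (k`!%:R * (N - k)`!%:R) :> R.
  by rewrite -bf; field; rewrite fk fnk.
rewrite /rho /stir !expr_div_n !exprMn.
have eN : expR N%:R = expR k%:R * expR (N - k)%:R :> R by rewrite -expRD -natrD subnKC.
have pN : (2:R) ^+ N = 2 ^+ k * 2 ^+ (N - k) by rewrite -exprD subnKC.
have NN : (N%:R : R) ^+ N = N%:R ^+ k * N%:R ^+ (N - k) by rewrite -exprD subnKC.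
rewrite eN pN NN.
have k1 := lt0r_neq0 (expR_gt0 (k%:R : R)); have k2 := lt0r_neq0 (expR_gt0 ((N - k)%:R : R)).
have k3 := lt0r_neq0 (exprnn_gt0 k); have k4 := lt0r_neq0 (exprnn_gt0 (N - k)).
have k5 : N%:R ^+ k != 0 :> R by rewrite expf_neq0.
have k6 : N%:R ^+ (N - k) != 0 :> R by rewrite expf_neq0.
move: (expR k%:R) (expR (N - k)%:R) (k%:R ^+ k) ((N - k)%:R ^+ (N - k)) (N%:R ^+ k)
 (N%:R ^+ (N - k)) (2 ^+ k) (2 ^+ (N - k)) k1 k2 k3 k4 k5 k6
 => a1 a2 a3 a4 a5 a6 a7 a8 k1 k2 k3 k4 k5 k6.
by field; rewrite fk fnk k1 k2 k3 k4 k5 k6.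
Qed.

End Stirling.

(** * Scaled limits of sequences *)

Section Sequences.
Context {R : realType}.
Local Notation rt n := (Num.sqrt (n%:R : R)).

Lemma sqrtn_cvgy : rt n @[n --> \oo] --> +oo.
Proof.
apply/cvgryPge => A.
have := @cvgr_idn R => /cvgryPge /(_ (A ^+ 2)).
apply: filterS => n hn; apply: le_trans (ler_norm A) _.
by rewrite -sqrtr_sqr ler_wsqrtr.
Qed.

Lemma sqrtnV_cvg0 : (rt n)^-1 @[n --> \oo] --> (0:R).
Proof.
apply/gtr0_cvgV0; last exact: sqrtn_cvgy.
by near=> n; rewrite sqrtr_gt0 ltr0n; near: n; exact: nbhs_infty_gt.
Unshelve. all: by end_near. Qed.

Lemma eq_cvg_near (u v : nat -> R) (l : R) :
  (\forall n \near \oo, u n = v n) -> u n @[n --> \oo] --> l -> v n @[n --> \oo] --> l.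
Proof. by move=> h ul; apply: cvg_trans ul; exact: near_eq_cvg. Qed.

Lemma cvgM_seq (u v : nat -> R) (a b : R) : u n @[n --> \oo] --> a ->
  v n @[n --> \oo] --> b -> u n * v n @[n --> \oo] --> a * b.
Proof. by move=> h1 h2; exact: cvgM h1 h2. Qed.

Lemma cvgD_seq (u v : nat -> R) (a b : R) : u n @[n --> \oo] --> a ->
  v n @[n --> \oo] --> b -> u n + v n @[n --> \oo] --> a + b.
Proof. by move=> h1 h2; exact: cvgD h1 h2. Qed.

Lemma cvgX_seq (u : nat -> R) (l : R) j : u n @[n --> \oo] --> l -> u n ^+ j @[n --> \oo] --> l ^+ j.
Proof. by move=> h; exact: (cvg_comp _ _ h (@exprn_continuous R j l)). Qed.

Lemma sqrtn_scaled_cvg0 (y : nat -> R) (l : R) : rt n * y n @[n --> \oo] --> l -> y n @[n --> \oo] --> (0:R).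
Proof.
move=> h; have := cvgM_seq sqrtnV_cvg0 h; rewrite mul0r => c; apply: eq_cvg_near c.
near=> n; rewrite /= mulrA mulVf ?mul1r// gt_eqF// sqrtr_gt0 ltr0n.
by near: n; exact: nbhs_infty_gt.
Unshelve. all: by end_near. Qed.

(** Deterministic delta method: a deviation of order [1 / sqrt n] is carried through the leading
    term of the expansion. *)
Lemma taylor_scaled (f : R -> R) (m l : R) j :
  little_o_at f m l j ->
  forall (y : nat -> R) (s : R), rt n * y n @[n --> \oo] --> s ->
  rt n ^+ j * (f (m + y n) - f m) @[n --> \oo] --> l * s ^+ j.
Proof.
move=> tf y s ys.
have y0 := sqrtn_scaled_cvg0 ys.
have main : l * (rt n * y n) ^+ j @[n --> \oo] --> l * s ^+ j.
  by apply: cvgM; [exact: cvg_cst|exact: cvgX_seq].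
have rem : rt n ^+ j * (f (m + y n) - f m - l * y n ^+ j) @[n --> \oo] --> (0:R).
  apply/cvgr0Pnorm_le => e e0.
  have s1 : 0 < (`|s| + 1) ^+ j by rewrite exprn_gt0// ltr_wpDl.
  (* Eventually [|rt n * y n| <= |s| + 1], so this tolerance makes the scaled remainder at most
     [e]. *)
  have [d d0 hd] := tf (e / (`|s| + 1) ^+ j) (divr_gt0 e0 s1).
  have /cvgr0Pnorm_le /(_ d d0) hy := y0.
  have /cvgrPdist_le /(_ 1 ltr01) hs := ys.
  near=> n.
  have yd : `|y n| <= d by near: n.
  have ysn : `|rt n * y n| <= `|s| + 1.
    rewrite -(subKr s (rt n * y n)); apply: le_trans (ler_normB _ _) _.
    by rewrite lerD2l; near: n.
  rewrite normrM ger0_norm ?exprn_ge0 ?sqrtr_ge0//.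
  apply: le_trans (ler_wpM2l _ (hd _ yd)) _; first by rewrite exprn_ge0// sqrtr_ge0.
  rewrite mulrCA -exprMn -[X in X * `|y n|]ger0_norm ?sqrtr_ge0// -normrM.
  rewrite -mulrA ger_pMr// mulrC ler_pdivrMr// mul1r.
  by apply: lerXn2r; rewrite // nnegrE ?addr_ge0.
have := cvgD_seq main rem; rewrite addr0 => c; apply: eq_cvg_near c.
by near=> n; rewrite /= exprMn; ring.
Unshelve. all: by end_near. Qed.

Lemma stir_ratio_cvg (a b : nat -> nat) :
  (\forall n \near \oo, (0 < a n)%N) -> (\forall n \near \oo, (0 < b n)%N) ->
  ((a n)%:R / (b n)%:R : R) @[n --> \oo] --> (1:R) ->
  (stir (a n) / stir (b n) : R) @[n --> \oo] --> (1:R).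
Proof.
move=> a0 b0 /cvgrPdist_le ab; apply/cvgrPdist_le => e e0.
have := ab e e0; near_simpl => h; near=> n.
have an : (0 < a n)%N by near: n.
have bn : (0 < b n)%N by near: n.
apply: (@le_trans _ _ (`|1 - (a n)%:R / (b n)%:R|)); last by near: n.
have := @stir_ratio_bounds R _ _ an bn.
set q := _ / _%:R; set r := stir _ / _.
case: (leP 1 q) => q1 /andP[r1 r2].
- by rewrite !ler0_norm ?subr_le0//; lra.
- by rewrite !ger0_norm ?subr_ge0//; lra.
Unshelve. all: by end_near. Qed.

Lemma magn_natE N k : (0 < N)%N -> k%:R = (1 + magn N k) / 2 * N%:R :> R.
Proof. by move=> N0; rewrite /magn; field; rewrite pnatr_eq0 -lt0n. Qed.

Lemma magn_subE N k : (0 < N)%N -> (k <= N)%N -> (N - k)%:R = (1 - magn N k) / 2 * N%:R :> R.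
Proof. by move=> N0 kN; rewrite /magn natrB//; field; rewrite pnatr_eq0 -lt0n. Qed.

Lemma magn_near (k : nat -> nat) (m : R) : -1 < m < 1 -> magn n (k n) @[n --> \oo] --> m ->
  \forall n \near \oo, [/\ (0 < n)%N, (0 < k n < n)%N & -1 < (magn n (k n) : R) < 1].
Proof.
move=> /andP[m0 m1] km; near=> n.
have n0 : (0 < n)%N by near: n; exact: nbhs_infty_gt.
have k1 : -1 < magn n (k n) :> R by near: n; exact: (cvgr_gt _ km).
have k2 : magn n (k n) < 1 :> R by near: n; exact: (cvgr_lt _ km).
split => //; last by rewrite k1 k2.
have nR : 0 < n%:R :> R by rewrite ltr0n.
by rewrite -(ltr0n R) -(ltr_nat R) (magn_natE _ n0) gtr_pMl// pmulr_lgt0// divr_gt0//=; lra.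
Unshelve. all: by end_near. Qed.

(** [stir n] cancels, leaving two ratios whose arguments are asymptotically equal because [1 + m]
    and [1 - m] are nonzero. *)
Lemma rho_ratio_cvg (k l : nat -> nat) (m : R) : -1 < m < 1 ->
  magn n (k n) @[n --> \oo] --> m -> magn n (l n) @[n --> \oo] --> m ->
  rho n (k n) / rho n (l n) @[n --> \oo] --> (1 : R).
Proof.
move=> hm km lm.
have nk := magn_near hm km; have nl := magn_near hm lm.
have c1 : (stir (l n) / stir (k n) : R) @[n --> \oo] --> (1:R).
  apply: stir_ratio_cvg.
  - by apply: filterS nl => n [_ /andP[]].
  - by apply: filterS nk => n [_ /andP[]].
  have m0 : 1 + m != 0 by rewrite gt_eqF//; lra.
  have c : (1 + magn n (l n)) / (1 + magn n (k n)) @[n --> \oo] --> (1 + m) / (1 + m).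
    by apply: cvgM; [|apply: cvgV => //]; apply: cvgD => //; exact: cvg_cst.
  rewrite divff// in c; apply: eq_cvg_near c.
  apply: filterS2 nk nl => n [n0 h1 h2] [_ h3 h4].
  rewrite [X in _ = X / _](magn_natE _ n0) [X in _ = _ / X](magn_natE _ n0); field.
  by rewrite pnatr_eq0 -lt0n n0 gt_eqF//; lra.
have c2 : (stir (n - l n) / stir (n - k n) : R) @[n --> \oo] --> (1:R).
  apply: stir_ratio_cvg.
  - by apply: filterS nl => n [_ /andP[_]]; rewrite subn_gt0.
  - by apply: filterS nk => n [_ /andP[_]]; rewrite subn_gt0.
  have m0 : 1 - m != 0 by rewrite gt_eqF//; lra.
  have c : (1 - magn n (l n)) / (1 - magn n (k n)) @[n --> \oo] --> (1 - m) / (1 - m).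
    by apply: cvgM; [|apply: cvgV => //]; apply: cvgB => //; exact: cvg_cst.
  rewrite divff// in c; apply: eq_cvg_near c.
  apply: filterS2 nk nl => n [n0 /andP[_ h1] h2] [_ /andP[_ h3] h4].
  rewrite [X in _ = X / _](magn_subE n0 (ltnW h3)) [X in _ = _ / X](magn_subE n0 (ltnW h1)); field.
  by rewrite pnatr_eq0 -lt0n n0 gt_eqF//; lra.
have := cvgM_seq c1 c2; rewrite mulr1 => c; apply: eq_cvg_near c.
near=> n; rewrite /= /rho; field.
by rewrite !gt_eqF ?stir_gt0.
Unshelve. all: by end_near. Qed.

End Sequences.

(** * Step functions on the magnetization lattice *)

Section StepFunctions.
Context {R : realType}.
Local Notation rt n := (Num.sqrt (n%:R : R)).
Local Notation mu := (@lebesgue_measure R).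
Implicit Types (N k : nat) (s : R).

(* Up to rounding, [s] is the rescaled magnetization [(magn N k - m) * sqrt N / (2 * a)]
   of the lattice index [k = truncn (lattice_index N s)]. *)
Variables (m a : R).
Hypothesis m01 : 0 < m < 1.
Hypothesis a0 : 0 < a.

Definition lattice_index N s : R := N%:R * (1 + m) / 2 + a * rt N * s.

Definition cell N k : set R :=
  `[(k%:R - N%:R * (1 + m) / 2) / (a * rt N), (k.+1%:R - N%:R * (1 + m) / 2) / (a * rt N)[.

Lemma cellP N k s : (0 < N)%N -> (s \in cell N k) = (k%:R <= lattice_index N s < k.+1%:R).
Proof.
move=> N0; have r0 : 0 < a * rt N by rewrite mulr_gt0// sqrtr_gt0 ltr0n.
rewrite mem_setE in_itv/= ler_pdivrMr// ltr_pdivlMr// /lattice_index.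
by rewrite (mulrC s); congr andb; [rewrite lerBlDl|rewrite ltrBrDl].
Qed.

Lemma measure_cell N k : (0 < N)%N -> mu (cell N k) = ((a * rt N)^-1)%:E.
Proof.
move=> N0; have r0 : 0 < a * rt N by rewrite mulr_gt0// sqrtr_gt0 ltr0n.
rewrite /cell lebesgue_measure_itv/= lte_fin ltr_pM2r ?invr_gt0// ltrD2r ltr_nat leqnn.
rewrite -EFinB; congr EFin; rewrite -mulrBl -natr1; field.
by rewrite gt_eqF ?sqrtr_gt0 ?ltr0n// gt_eqF.
Qed.

(** Turns a lattice sum into an integral: all cells have length [1 / (a * sqrt N)], so dominated
    convergence applies to the normalized sum. *)
Definition step (b : nat -> R) N s : R := \sum_(k < N.+1) b k * \1_(cell N k) s.

Lemma step_truncn b N s : (0 < N)%N -> 0 <= lattice_index N s -> (Num.truncn (lattice_index N s) <= N)%N ->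
  step b N s = b (Num.truncn (lattice_index N s)).
Proof.
move=> N0 u0 uN.
rewrite /step (bigD1 (Ordinal (uN : (Num.truncn _ < N.+1)%N)))//= big1 ?addr0.
  by rewrite indicE cellP// truncn_itv// mulr1.
move=> k /negP kn; rewrite indicE cellP//.
case: (boolP (_ && _)) => h; last by rewrite mulr0.
by exfalso; apply: kn; rewrite -val_eqE /= (truncn_def h).
Qed.

Lemma step_out b N s : (0 < N)%N -> ~~ ((0 <= lattice_index N s) && (Num.truncn (lattice_index N s) <= N)%N) ->
  step b N s = 0.
Proof.
move=> N0 h; rewrite /step big1// => k _; rewrite indicE cellP//.
case: (boolP (_ && _)) => hk; last by rewrite mulr0.
exfalso; move/negP: h; apply.
have -> : 0 <= lattice_index N s by case/andP: hk => hk _; apply: le_trans hk.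
by rewrite (truncn_def hk) -ltnS ltn_ord.
Qed.

Lemma measurable_step b N : measurable_fun setT (step b N).
Proof.
apply: measurable_sum => k; apply: measurable_funM; first exact: measurable_cst.
by apply: measurable_indic; exact: measurable_itv.
Qed.

Lemma integral_step b N : (0 < N)%N -> (forall k, 0 <= b k) ->
  (\int[mu]_s (step b N s)%:E)%E = ((a * rt N)^-1 * \sum_(k < N.+1) b k)%:E.
Proof.
move=> N0 b0; rewrite /step.
under eq_integral do rewrite -sumEFin.
rewrite ge0_integral_sum//; last 2 first.
- move=> k; apply/measurable_EFinP; apply: measurable_funM; first exact: measurable_cst.
  by apply: measurable_indic; exact: measurable_itv.
- by move=> k s _; rewrite lee_fin mulr_ge0// indicE.
rewrite mulr_sumr -sumEFin; apply: eq_bigr => k _.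
under eq_integral do rewrite EFinM.
rewrite ge0_integralZl_EFin//; last first.
- by apply/measurable_EFinP; apply: measurable_indic; exact: measurable_itv.
rewrite integral_indic//; last exact: measurable_itv.
rewrite setIT [X in (_ * X)%E](_ : _ = ((a * rt N)^-1)%:E); last exact: measure_cell.
by rewrite -EFinM mulrC.
Qed.

Lemma lattice_indexE N s : (0 < N)%N -> lattice_index N s = ((1 + m) / 2 + a * s / rt N) * N%:R.
Proof.
move=> N0; have r0 : 0 < rt N by rewrite sqrtr_gt0 ltr0n.
rewrite /lattice_index; have -> : a * rt N * s = a * s / rt N * (rt N ^+ 2).
  by field; rewrite gt_eqF.
by rewrite sqr_sqrtr//; ring.
Qed.

Lemma lattice_index_range s :
  \forall N \near \oo, 0 <= lattice_index N s /\ (Num.truncn (lattice_index N s) <= N)%N.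
Proof.
have /andP[m0 m1] := m01.
have p0 : 0 < (1 + m) / 2 by rewrite divr_gt0// addr_gt0.
have p1 : (1 + m) / 2 < 1 by rewrite ltr_pdivrMr//; lra.
have h : (1 + m) / 2 + a * s * (rt N)^-1 @[N --> \oo] --> ((1 + m) / 2 + a * s * 0 : R).
  apply: cvgD_seq; first exact: cvg_cst.
  by apply: cvgM_seq; [exact: cvg_cst|exact: sqrtnV_cvg0].
rewrite mulr0 addr0 in h.
have h0 : \forall N \near \oo, 0 < (1 + m) / 2 + a * s * (rt N)^-1 by exact: (cvgr_gt _ h).
have h1 : \forall N \near \oo, (1 + m) / 2 + a * s * (rt N)^-1 < 1 by exact: (cvgr_lt _ h).
near=> N.
have N0 : (0 < N)%N by near: N; exact: nbhs_infty_gt.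
have n0 : 0 < N%:R :> R by rewrite ltr0n.
have u0 : 0 <= lattice_index N s by rewrite lattice_indexE// mulr_ge0// ltW//; near: N.
split => //; rewrite -ltnS truncn_lt_nat// lattice_indexE//.
apply: (@lt_trans _ _ N%:R); last by rewrite ltr_nat.
by rewrite gtr_pMl//; near: N.
Unshelve. all: by end_near. Qed.

(** Rounding costs at most one lattice spacing [2 / N], negligible at scale [1 / sqrt N]. *)
Lemma magn_index_bound N s k : (0 < N)%N -> k%:R <= lattice_index N s < k.+1%:R ->
  `|magn N k - m - 2 * a * s / rt N| <= 2 / N%:R.
Proof.
move=> N0; have n0 : 0 < N%:R :> R by rewrite ltr0n.
have r0 : 0 < rt N by rewrite sqrtr_gt0.
rewrite (lattice_indexE _ N0) -[k.+1%:R]natr1 [k%:R](magn_natE k N0) => /andP[h1 h2].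
rewrite ler_pM2r// in h1.
have h3 : (1 + m) / 2 + a * s / rt N < (1 + magn N k) / 2 + N%:R^-1.
  by rewrite -(ltr_pM2r n0) [X in _ < X]mulrDl mulVf ?gt_eqF.
have -> : 2 * a * s / rt N = 2 * (a * s / rt N) by ring.
rewrite ler_norml; move: h1 h3; set x := _ / rt N; set y := N%:R^-1; set z := magn N k.
by move=> h1 h3; have y0 : 0 < y; [by rewrite invr_gt0|lra].
Qed.

Lemma magn_index_cvg s :
  rt N * (magn N (Num.truncn (lattice_index N s)) - m) @[N --> \oo] --> 2 * a * s.
Proof.
have h : 2 * (rt N)^-1 @[N --> \oo] --> (2 * 0 : R).
  by apply: cvgM_seq; [exact: cvg_cst|exact: sqrtnV_cvg0].
rewrite mulr0 in h; apply/cvgrPdist_le => e e0.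
have {}h : \forall N \near \oo, 2 * (rt N)^-1 <= e by exact: (cvgr_le _ h).
have hr := lattice_index_range s.
near=> N.
have N0 : (0 < N)%N by near: N; exact: nbhs_infty_gt.
have n0 : 0 < N%:R :> R by rewrite ltr0n.
have r0 : 0 < rt N by rewrite sqrtr_gt0.
have [u0 uN] : 0 <= lattice_index N s /\ (Num.truncn (lattice_index N s) <= N)%N by near: N.
have := magn_index_bound N0 (truncn_itv u0).
set z := magn _ _ => hz.
rewrite distrC (_ : _ - _ = rt N * (z - m - 2 * a * s / rt N)); last first.
  by field; rewrite gt_eqF.
rewrite normrM gtr0_norm//; apply: le_trans (ler_wpM2l (ltW r0) hz) _.
rewrite -[in N%:R^-1](sqr_sqrtr (ltW n0)).
rewrite (_ : _ * _ = 2 / rt N); last by field; rewrite gt_eqF.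
by near: N.
Unshelve. all: by end_near. Qed.

End StepFunctions.

(** * Laplace asymptotics near the maximizer *)

Section Laplace.
Context {R : realType}.
Local Notation rt n := (Num.sqrt (n%:R : R)).
Local Notation mu := (@lebesgue_measure R).
Implicit Types (N k : nat) (s : R).

Lemma integrable_gauss (b : R) : 0 < b ->
  mu.-integrable setT (fun s => (expR (- (b * s ^+ 2)))%:E).
Proof.
move=> b0.
pose sg := Num.sqrt (2 * b)^-1.
have sg0 : sg != 0 by rewrite gt_eqF// sqrtr_gt0 invr_gt0 mulr_gt0.
have pk := normal_peak_gt0 sg0.
rewrite (_ : (fun s => _) = (fun s => ((normal_peak sg)^-1%:E * (normal_pdf 0 sg s)%:E)%E)); last first.
  apply/funext => s; rewrite -EFinM normal_pdfE// mulKf ?gt_eqF//; congr (expR _)%:E.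
  rewrite /sg sqr_sqrtr ?invr_ge0 ?mulr_ge0 ?ltW// subr0 -mulr_natr; field.
  by rewrite gt_eqF.
by apply: integrableZl => //; exact: integrable_normal_pdf.
Qed.

Lemma cvg_sub0_seq (u : nat -> R) (l : R) :
  u n - l @[n --> \oo] --> (0 : R) -> u n @[n --> \oo] --> l.
Proof.
move=> ul; have h : l + (u n - l) @[n --> \oo] --> l + 0.
  by apply: cvgD_seq => //; exact: cvg_cst.
rewrite addr0 in h; apply: eq_cvg_near h.
by near=> n; rewrite addrCA subrr addr0.
Unshelve. all: by end_near. Qed.

(** [taylor] determines the pointwise limit of the weights; the quadratic bound [gc] on the window
    of radius [d] gives the Gaussian domination. *)
Variables (g : R -> R) (m a G2 d c : R).
Hypothesis m01 : 0 < m < 1.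
Hypothesis a0 : 0 < a.
Hypothesis taylor : little_o_at g m (G2 / 2) 2.
Hypothesis d0 : 0 < d.
Hypothesis dm : d <= m.
Hypothesis dm1 : d <= (1 - m) / 2.
Hypothesis c0 : 0 < c.
Hypothesis gc : forall h, `|h| <= d -> g (m + h) - g m <= - (c * h ^+ 2).

(** Reference lattice point next to [m]; dividing by its [rho] normalizes the weights. *)
Definition k0 N := Num.truncn (lattice_index m a N 0).
Definition qweight N k : R :=
  expR (N%:R * (g (magn N k) - g m)) * (rho N k / rho N (k0 N)).
Definition nearm N k := `|magn N k - m| <= d.

Lemma qweight_ge0 N k : 0 <= qweight N k.
Proof. by rewrite mulr_ge0 ?expR_ge0// divr_ge0// ltW// rho_gt0. Qed.

Lemma k0_itv N : (1 < N)%N -> (0 < k0 N < N)%N.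
Proof.
have /andP[m0 m1] := m01.
move=> N1; have N0 : (0 < N)%N by exact: ltnW.
have n0 : 0 < N%:R :> R by rewrite ltr0n.
have n2 : 2 <= N%:R :> R by rewrite ler_nat.
have e : lattice_index m a N 0 = (1 + m) / 2 * N%:R by rewrite lattice_indexE// mulr0 mul0r addr0.
have h1 : 1 <= lattice_index m a N 0.
  rewrite e; apply: (@le_trans _ _ ((1 + m) / 2 * 2)); last by rewrite ler_wpM2l//; lra.
  by rewrite divfK//; lra.
rewrite truncn_gt0 h1 truncn_lt_nat; last by lra.
by rewrite e gtr_pMl// ltr_pdivrMr//; lra.
Qed.

Lemma stir_ratio_ub N n k (w : R) : (0 < n <= N)%N -> (0 < k)%N -> 0 < w <= 1 ->
  w * N%:R <= k%:R -> stir n / stir k <= w^-1.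
Proof.
move=> /andP[n0 nN] k0 /andP[w0 w1] hk.
have kk : 0 < k%:R :> R by rewrite ltr0n.
have /andP[_ h] := @stir_ratio_bounds R n k n0 k0.
apply: le_trans h _; rewrite ge_max invf_ge1// w1/= ler_pdivrMr// ler_pdivlMl//.
by apply: le_trans hk; rewrite ler_wpM2l ?(ltW w0)// ler_nat.
Qed.

Lemma rho_ratio_ub N k : (1 < N)%N -> (k <= N)%N -> nearm N k ->
  rho N k / rho N (k0 N) <= 8 / (1 - m).
Proof.
have /andP[m0 m1] := m01; have hd := dm; have hd1 := dm1.
move=> N1 kN; rewrite /nearm ler_norml => /andP[h1 h2].
have N0 : (0 < N)%N by exact: ltnW.
have n0 : 0 < N%:R :> R by rewrite ltr0n.
have /andP[k00 k0N] := k0_itv N1.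
have -> : rho N k / rho N (k0 N) = (stir (k0 N) / stir k) * (stir (N - k0 N) / stir (N - k)) :> R.
  by rewrite /rho; field; rewrite !gt_eqF ?stir_gt0.
(* In the window the magnetization lies between 0 and [(1 + m) / 2], so [k >= N / 2] and
   [N - k >= (1 - m) / 4 * N]. *)
have -> : 8 / (1 - m) = (1 / 2)^-1 * ((1 - m) / 4)^-1.
  by field; rewrite gt_eqF//; lra.
have b1 : 1 / 2 * N%:R <= k%:R :> R by rewrite (magn_natE k N0) ler_wpM2r//; lra.
have b2 : (1 - m) / 4 * N%:R <= (N - k)%:R :> R by rewrite (magn_subE N0 kN) ler_wpM2r//; lra.
have p1 : (0 < k)%N by rewrite -(ltr0n R) (lt_le_trans _ b1)// mulr_gt0.
have p2 : (0 < N - k)%N.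
  by rewrite -(ltr0n R) (lt_le_trans _ b2)// mulr_gt0// divr_gt0//; lra.
apply: ler_pM; rewrite ?divr_ge0 ?(ltW (stir_gt0 _))//.
- by apply: (@stir_ratio_ub N) => //; [rewrite k00 ltnW|lra].
- by apply: (@stir_ratio_ub N) => //; [rewrite subn_gt0 k0N leq_subr|lra].
Qed.

(** In the rescaled coordinate the events [E N] converge to [D], except possibly at the single point
    [t0], which has measure zero. *)
Variables (E : nat -> nat -> bool) (D : set R) (t0 : R).
Hypothesis mD : measurable D.
Hypothesis ED : forall s, s != t0 ->
  \forall N \near \oo, E N (Num.truncn (lattice_index m a N s)) = (s \in D).

Let b N k := if nearm N k && E N k then qweight N k else 0.

Let b_ge0 N k : 0 <= b N k.
Proof. by rewrite /b; case: ifP => // _; exact: qweight_ge0. Qed.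

Lemma step_dominated N s : (1 < N)%N ->
  `|step m a (b N) N s| <= expR (4 * c) * (8 / (1 - m)) * expR (- (2 * c * a ^+ 2 * s ^+ 2)).
Proof.
move=> N1; have N0 : (0 < N)%N by exact: ltnW.
have n0 : 0 < N%:R :> R by rewrite ltr0n.
have r0 : 0 < rt N by rewrite sqrtr_gt0.
have r1 : 1 <= rt N by rewrite -[X in X <= _]sqrtr1 ler_wsqrtr// ler1n.
have /andP[m0 m1] := m01.
have C0 : 0 <= expR (4 * c) * (8 / (1 - m)) * expR (- (2 * c * a ^+ 2 * s ^+ 2)).
  by rewrite !mulr_ge0 ?expR_ge0 ?invr_ge0//; lra.
case: (boolP ((0 <= lattice_index m a N s) && (Num.truncn (lattice_index m a N s) <= N)%N)); last first.
  by move=> /step_out ->//; rewrite normr0.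
move=> /andP[u0 uN]; rewrite step_truncn// ger0_norm//.
rewrite /b; case: ifP => // /andP[hn _].
have hb := magn_index_bound N0 (truncn_itv u0).
move: hb hn (rho_ratio_ub N1 uN hn); rewrite /nearm /qweight.
move: (Num.truncn _) => k hb hn hr.
apply: (@le_trans _ _ (expR (4 * c - 2 * c * a ^+ 2 * s ^+ 2) * (8 / (1 - m)))); last first.
  by rewrite expRD mulrAC.
apply: ler_pM => //; first by apply: divr_ge0; exact/ltW/rho_gt0.
rewrite ler_expR.
have := gc hn; rewrite addrCA subrr addr0; set y := magn N k - m in hb hn *.
move=> hg; apply: (@le_trans _ _ (- (c * (rt N * y) ^+ 2))).
  rewrite exprMn sqr_sqrtr ?(ltW n0)// (_ : - (c * _) = N%:R * - (c * y ^+ 2)); last by ring.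
  by rewrite ler_wpM2l// ltW.
have hz : `|rt N * y - 2 * a * s| <= 2.
  rewrite (_ : _ - _ = rt N * (y - 2 * a * s / rt N)); last by field; rewrite gt_eqF.
  rewrite normrM gtr0_norm//; apply: le_trans (ler_wpM2l (ltW r0) hb) _.
  rewrite -[in N%:R^-1](sqr_sqrtr (ltW n0)) (_ : _ * _ = 2 / rt N); last by field; rewrite gt_eqF.
  by rewrite ler_pdivrMr//; lra.
have hz2 : (rt N * y - 2 * a * s) ^+ 2 <= 4.
  by rewrite -[leLHS]real_normK ?num_real// (_ : 4 = 2 ^+ 2) ?ler_pXn2r ?nnegrE//; ring.
(* With [u = 2 * a * s], this is [z^2 >= u^2 / 2 - (z - u)^2], the last square being at most 4. *)
have : 2 * a ^+ 2 * s ^+ 2 - 4 <= (rt N * y) ^+ 2.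
  by move: hz2; set z := rt N * y; have := sqr_ge0 (2 * z - 2 * a * s); nra.
by move: (rt N * y) => z; have := c0; nra.
Qed.

Lemma step_cvg s : s != t0 ->
  step m a (b N) N s @[N --> \oo] --> (if s \in D then expR (2 * a ^+ 2 * G2 * s ^+ 2) else 0).
Proof.
move=> st; have /andP[m0 m1] := m01.
have zc := @magn_index_cvg R m a m01 s.
have yc := sqrtn_scaled_cvg0 zc.
have tc := taylor_scaled taylor zc.
have hm : magn N (Num.truncn (lattice_index m a N s)) @[N --> \oo] --> m.
  exact: cvg_sub0_seq yc.
have hk0 : magn N (k0 N) @[N --> \oo] --> m.
  have yc0 := sqrtn_scaled_cvg0 (@magn_index_cvg R m a m01 0).
  exact: cvg_sub0_seq yc0.
have hr := rho_ratio_cvg (_ : -1 < m < 1) hm hk0.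
have {}hr := hr ltac:(lra).
have hq : qweight N (Num.truncn (lattice_index m a N s)) @[N --> \oo] --> expR (2 * a ^+ 2 * G2 * s ^+ 2).
  rewrite -[X in _ --> X]mulr1; apply: cvgM_seq => //.
  have := tc; rewrite (_ : G2 / 2 * (2 * a * s) ^+ 2 = 2 * a ^+ 2 * G2 * s ^+ 2); last by field.
  move=> h; have {}h : N%:R * (g (magn N (Num.truncn (lattice_index m a N s))) - g m) @[N --> \oo] -->
      2 * a ^+ 2 * G2 * s ^+ 2.
    apply: eq_cvg_near h; near=> N.
    by rewrite addrCA subrr addr0 sqr_sqrtr.
  exact: (cvg_comp _ _ h (@continuous_expR R _)).
have hE := ED st; have hrange := lattice_index_range a m01 s.
have /cvgr0Pnorm_le /(_ d d0) hnear := yc.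
have h0 : (fun _ : nat => 0 : R) n @[n --> \oo] --> (0 : R) by exact: cvg_cst.
case: ifP => sD; [apply: eq_cvg_near hq|apply: eq_cvg_near h0];
  near=> N.
- have N0 : (0 < N)%N by near: N; exact: nbhs_infty_gt.
  have [u0 uN] : 0 <= lattice_index m a N s /\ (Num.truncn (lattice_index m a N s) <= N)%N by near: N.
  have e : E N (Num.truncn (lattice_index m a N s)) = (s \in D) by near: N.
  have hn : nearm N (Num.truncn (lattice_index m a N s)) by near: N.
  by rewrite step_truncn// /b hn e sD.
- have N0 : (0 < N)%N by near: N; exact: nbhs_infty_gt.
  have [u0 uN] : 0 <= lattice_index m a N s /\ (Num.truncn (lattice_index m a N s) <= N)%N by near: N.
  have e : E N (Num.truncn (lattice_index m a N s)) = (s \in D) by near: N.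
  by rewrite step_truncn// /b e sD andbF.
Unshelve. all: by end_near. Qed.

Lemma laplace_limit :
  ((a * rt N)^-1 * \sum_(k < N.+1) b N k)%:E @[N --> \oo] -->
  (\int[mu]_(s in D) (expR (2 * a ^+ 2 * G2 * s ^+ 2))%:E)%E.
Proof.
pose f s := (if s \in D then expR (2 * a ^+ 2 * G2 * s ^+ 2) else 0)%:E : \bar R.
have -> : (\int[mu]_(s in D) (expR (2 * a ^+ 2 * G2 * s ^+ 2))%:E = \int[mu]_s f s)%E.
  rewrite integral_mkcond; apply: eq_integral => s _.
  by rewrite /patch /f; case: ifP.
(* The domination is available for [1 < N], hence the shift of the index by 2. *)
rewrite -(cvg_shiftn 2).
have mf : measurable_fun setT f.
  apply/measurable_EFinP; apply: measurable_fun_ifT => //.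
  - by apply: (measurable_fun_bool true); rewrite setTI (_ : _ @^-1` _ = D)//; apply/seteqP; split => s /=; [exact: set_mem|exact: mem_set].
  - by apply: measurableT_comp => //; apply: measurable_funM.
have [|||| _ _] := @dominated_convergence _ _ R mu setT measurableT
  (fun n s => (step m a (b (n + 2)%N) (n + 2) s)%:E) f
  (fun s => ((expR (4 * c) * (8 / (1 - m)))%:E * (expR (- (2 * c * a ^+ 2 * s ^+ 2)))%:E)%E) _ mf.
- by move=> n; apply/measurable_EFinP; exact: measurable_step.
- exists [set t0]; split; [exact: measurable_set1|exact: lebesgue_measure_set1|].
  move=> s /= hs; apply: contrapT => /eqP st; apply: hs => _.
  apply: cvg_EFin; first by near=> n.
  have := step_cvg st; rewrite -(cvg_shiftn 2); exact.
- apply: integrableZl => //; apply: integrable_gauss.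
  by rewrite !mulr_gt0// exprn_gt0.
- apply: aeW => s n _; rewrite abse_EFin -EFinM lee_fin; apply: step_dominated.
  by rewrite addn2.
apply: cvg_trans; apply: near_eq_cvg; near=> n => /=.
by rewrite integral_step// addn2.
Unshelve. all: by end_near. Qed.

End Laplace.

(** * Configurations, magnetization and the estimator *)

Section Configurations.
Context {R : realType}.
Local Notation rt n := (Num.sqrt (n%:R : R)).

Definition ups N (x : config N) : nat := #|[pred i | x i]|.

Lemma sum_spin N (x : config N) : (0 < N)%N ->
  \sum_(i < N) spin R (x i) = N%:R * magn N (ups x).
Proof.
move=> N0; rewrite /magn mulrBr mulr1 mulrCA divff ?pnatr_eq0 -?lt0n// mulr1.
have -> : \sum_(i < N) spin R (x i) = \sum_(i < N) (2 * (x i)%:R - 1).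
  by apply: eq_bigr => i _; rewrite /spin; case: (x i) => /=; ring.
rewrite sumrB -mulr_sumr sumr_const card_ord /ups -sum1_card natr_sum [in RHS]big_mkcond /=.
by congr (_ * _ - _); apply: eq_bigr => i _; rewrite inE; case: (x i).
Qed.

Lemma sum_ffun_prod N p (f : 'I_N -> R) :
  \sum_(iota : {ffun 'I_p -> 'I_N}) \prod_(k < p) f (iota k) = (\sum_(i < N) f i) ^+ p.
Proof. by rewrite -(bigA_distr_bigA (fun (_ : 'I_p) i => f i)) prodr_const card_ord. Qed.

Lemma Ham_magn N p (x : config N) : (0 < N)%N -> (0 < p)%N ->
  Ham R p x = N%:R * magn N (ups x) ^+ p.
Proof.
move=> N0 p0; have n0 : N%:R != 0 :> R by rewrite pnatr_eq0 -lt0n.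
rewrite /Ham -mulr_sumr (sum_ffun_prod _ (fun i => spin R (x i))) sum_spin// /Jcw exprMn mulrA; congr (_ * _).
by case: p p0 => // p _; rewrite exprS /= mulrCA mulVf ?mulr1// expf_neq0.
Qed.

Lemma mloc_magn N p (x : config N) i : (0 < N)%N ->
  mloc R p x i = magn N (ups x) ^+ p.-1.
Proof.
move=> N0; have n0 : N%:R != 0 :> R by rewrite pnatr_eq0 -lt0n.
by rewrite /mloc -mulr_sumr (sum_ffun_prod _ (fun i => spin R (x i))) sum_spin// /Jcw exprMn mulrA mulVf ?mul1r// expf_neq0.
Qed.

(** Configurations correspond to subsets of ['I_N], grouped by cardinality. *)
Lemma sum_config N (f : nat -> R) :
  \sum_(x : config N) f (ups x) = \sum_(k < N.+1) 'C(N, k)%:R * f k.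
Proof.
rewrite (reindex (fun A : {set 'I_N} => [ffun i => i \in A] : config N)) /=; last first.
  exists (fun x : config N => finset (fun i => x i)) => [A _|x _].
    by apply/setP => i; rewrite inE ffunE.
  by apply/ffunP => i; rewrite ffunE inE.
have hu (A : {set 'I_N}) : ups ([ffun i => i \in A] : config N) = #|A|.
  by rewrite /ups; apply: eq_card => i; rewrite inE ffunE.
rewrite (partition_big (fun A : {set 'I_N} => inord #|A| : 'I_N.+1) predT)//=.
apply: eq_bigr => k _.
rewrite (eq_bigr (fun=> f k)); last first.
  move=> A /eqP <-; rewrite hu inordK// ltnS.
  by rewrite -[X in (_ <= X)%N](card_ord N) max_card.
rewrite sumr_const -[LHS]mulr_natl; congr (_ * _); congr (_%:R).
have := card_draws 'I_N k; rewrite card_ord => <-.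
rewrite cardsE; apply: eq_card => A; rewrite /in_mem /= inordK// ltnS.
by rewrite -[X in (_ <= X)%N](card_ord N) max_card.
Qed.

(** The estimator as a function of the magnetization, with the common factor [N] of both sides of
    the equation cancelled. *)
Definition mplm p (t : R) : \bar R := ereal_inf [set b%:E | b in [set b : R | 0 <= b /\
     t ^+ p = t ^+ p.-1 * tanh (p%:R * b * t ^+ p.-1)]].

Lemma mpl_magn N p (x : config N) : (0 < N)%N -> (0 < p)%N ->
  mpl R p x = mplm p (magn N (ups x)).
Proof.
move=> N0 p0; have n0 : N%:R != 0 :> R by rewrite pnatr_eq0 -lt0n.
rewrite /mpl /mplm; congr (ereal_inf [set _ | _ in _]).
apply/seteqP; split => b /= [b0 H]; split => //; move: H; rewrite Ham_magn//.
- under eq_bigr do rewrite mloc_magn//.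
  by rewrite sumr_const card_ord -[X in _ = X -> _]mulr_natl => H; exact: (mulfI n0 H).
- move=> H; under eq_bigr do rewrite mloc_magn//.
  by rewrite sumr_const card_ord -[RHS]mulr_natl H.
Qed.

Lemma tanhN (y : R) : tanh (- y) = - tanh y.
Proof. by rewrite /tanh opprK -mulNr opprB (addrC (expR (- y)) (expR y)). Qed.

(** Both [t ^+ p.-1] and [tanh] change sign. Hence events about the estimator are symmetric, and the
    wells at [m] and [-m] contribute equally. *)
Lemma mplmN p (t : R) : (0 < p)%N -> ~~ odd p -> mplm p (- t) = mplm p t.
Proof.
case: p => // p _ /= ep; rewrite negbK in ep.
rewrite /mplm; congr ereal_inf; congr image.
have e1 : (- t) ^+ p = - t ^+ p by rewrite exprNn -signr_odd ep expr1 mulN1r.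
have e2 : (- t) ^+ p.+1 = t ^+ p.+1 by rewrite exprS e1 mulrNN -exprS.
by apply/seteqP; split => b /= [b0]; rewrite e1 e2 mulrN tanhN mulrNN.
Qed.

(** Dividing by [t ^+ p.-1] and applying [atanh] leaves exactly one solution, so the infimum is over
    a singleton. *)
Lemma mplm_phi p (t : R) : (2 <= p)%N -> 0 < t < 1 -> mplm p t = (phi p t)%:E.
Proof.
move=> p2 ht; have /andP[t0 t1] := ht.
have pp : 0 < p%:R :> R by rewrite ltr0n; case: p p2.
have tp : 0 < t ^+ p.-1 by rewrite exprn_gt0.
have E : t ^+ p = t ^+ p.-1 * t by rewrite -exprSr; case: p p2 {pp tp}.
rewrite /mplm -[RHS]ereal_inf1; congr ereal_inf; apply/seteqP; split => y /=.
- move=> [b [b0 H] <-]; congr EFin; move: H; rewrite E => /(mulfI (lt0r_neq0 tp)) H.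
  by rewrite /phi {1}H tanhK; field; rewrite !gt_eqF.
- move=> ->; exists (phi p t) => //; split.
    by apply/ltW/divr_gt0; [exact: atanh_gt0|exact: mulr_gt0].
  have -> : p%:R * phi p t * t ^+ p.-1 = atanh t by rewrite /phi; field; rewrite !gt_eqF.
  by rewrite atanhK; [exact: E|lra].
Qed.

(** The prefactor of [qweight] does not depend on [k], so it cancels in Gibbs probabilities. *)
Lemma qweight_bin p (beta m a : R) N k : (0 < N)%N -> (k <= N)%N ->
  'C(N, k)%:R * expR (beta * (N%:R * magn N k ^+ p)) =
  2 ^+ N * expR (N%:R * gfun beta p m) * rho N (k0 m a N) * qweight (gfun beta p) m a N k.
Proof.
move=> N0 kN; rewrite /qweight.
have -> : N%:R * (gfun beta p (magn N k) - gfun beta p m) =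
   beta * (N%:R * magn N k ^+ p) - N%:R * Ient (magn N k) - N%:R * gfun beta p m.
  by rewrite {1}/gfun; ring.
rewrite !expRB.
have := @bin_magn R N k N0 kN.
have h1 := lt0r_neq0 (expR_gt0 (N%:R * Ient (magn N k : R))).
have h2 := lt0r_neq0 (expR_gt0 (N%:R * gfun beta p m)).
have h3 := lt0r_neq0 (@rho_gt0 R N (k0 m a N)).
move: (expR (N%:R * Ient _)) (expR (N%:R * gfun _ _ _)) (rho N (k0 m a N)) h1 h2 h3 => e1 e2 r h1 h2 h3 H.
have -> : 'C(N, k)%:R = 2 ^+ N * rho N k / e1 :> R by rewrite -H mulfK.
by field; rewrite h1 h2 h3.
Qed.

Lemma gibbs_probE p (beta m a : R) N (A : pred nat) : (0 < N)%N -> (0 < p)%N ->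
  gibbs_prob p beta (fun x : config N => A (ups x)) =
  (\sum_(k < N.+1) if A k then qweight (gfun beta p) m a N k else 0) /
  (\sum_(k < N.+1) qweight (gfun beta p) m a N k).
Proof.
move=> N0 p0; rewrite /gibbs_prob /gibbs_weight.
have H (B : pred nat) : \sum_(x : config N | B (ups x)) expR (beta * Ham R p x) =
   2 ^+ N * expR (N%:R * gfun beta p m) * rho N (k0 m a N) *
   \sum_(k < N.+1) if B k then qweight (gfun beta p) m a N k else 0.
  under eq_bigr do rewrite Ham_magn//.
  rewrite big_mkcond (sum_config N (fun k => if B k then expR (beta * (N%:R * magn N k ^+ p)) else 0)).
  rewrite mulr_sumr; apply: eq_bigr => k _; case: ifP => _; last by rewrite !mulr0.
  by rewrite (@qweight_bin p beta m a)// -ltnS.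
rewrite (H A) (H predT) /=.
have C0 : 2 ^+ N * expR (N%:R * gfun beta p m) * rho N (k0 m a N) != 0.
  by apply/lt0r_neq0/mulr_gt0; [rewrite mulr_gt0 ?exprn_gt0 ?expR_gt0|exact: rho_gt0].
by rewrite -mulf_div divff// mul1r.
Qed.

Lemma integral_gauss_normal (v : R) (D : set R) : 0 < v -> measurable D ->
  (\int[lebesgue_measure]_(s in D) (expR (- (s ^+ 2 / (2 * v))))%:E =
  ((normal_peak (Num.sqrt v))^-1 * fine (normal_prob 0 (Num.sqrt v) D))%:E)%E.
Proof.
move=> v0 mD.
have sg0 : Num.sqrt v != 0 by rewrite gt_eqF// sqrtr_gt0.
have pk := normal_peak_gt0 sg0.
rewrite EFinM fineK; last by rewrite fin_num_measure.
rewrite /normal_prob -integralZl//; last first.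
  by apply: integrableS (integrable_normal_pdf _ _) => //.
apply: eq_integral => s _; rewrite -EFinM normal_pdfE// mulKf ?gt_eqF//; congr (expR _)%:E.
rewrite sqr_sqrtr ?ltW// subr0 -mulr_natr; field.
by rewrite gt_eqF.
Qed.

End Configurations.

(** * Concentration and the central limit theorem *)

Section Concentration.
Context {R : realType}.
Local Notation rt n := (Num.sqrt (n%:R : R)).
Variables (p : nat) (beta m a d eta : R).
Hypothesis p2 : (2 <= p)%N.
Hypothesis beta0 : 0 <= beta.
Hypothesis m01 : 0 < m < 1.
Hypothesis a0 : 0 < a.
Hypothesis d0 : 0 < d.
Hypothesis dm : d <= m / 2.
Hypothesis eta0 : 0 < eta.
Hypothesis eta_max : eta <= gfun beta p m.
Hypothesis sep : forall t, 0 <= t <= 1 -> d < `|t - m| ->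
  gfun beta p t <= gfun beta p m - eta.

Local Notation q := (qweight (gfun beta p) m a).
Local Notation near := (nearm m d).

(** Indices near [-m], a second well present for even [p] only. *)
Definition mirror N k := ~~ odd p && near N (N - k).
Definition far N k := ~~ near N k && ~~ mirror N k.

Lemma gfunN (t : R) : ~~ odd p -> gfun beta p (- t) = gfun beta p t.
Proof. by move=> ep; rewrite /gfun IentN exprNn -signr_odd (negbTE ep) expr0 mul1r. Qed.

Lemma gfun_odd_le0 (t : R) : odd p -> -1 <= t <= 0 -> gfun beta p t <= 0.
Proof.
move=> op ht; rewrite /gfun -[t in t ^+ p]opprK exprNn -signr_odd op expr1 mulN1r.
have := @Ient_ge0 R t ltac:(lra).
have : 0 <= beta * (- t) ^+ p by rewrite mulr_ge0// exprn_ge0//; lra.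
rewrite mulrN; lra.
Qed.

Lemma qweightN N k : ~~ odd p -> (0 < N)%N -> (k <= N)%N -> q N (N - k) = q N k.
Proof. by move=> ep N0 kN; rewrite /qweight magn_sub// gfunN// rho_sub. Qed.

(** The cubic factor combines [rho_le] and [rho_inv_le]. The gap in [g] comes from [sep] for
    nonnegative magnetization, and otherwise from [g <= 0] (odd [p]) or reflection (even [p]). *)
Lemma far_bound N k : (1 < N)%N -> (k <= N)%N -> far N k ->
  q N k <= (expR 1 * N%:R) ^+ 3 * expR (- (eta * N%:R)).
Proof.
move=> N1 kN /andP[]; rewrite /nearm -ltNge => fk mk.
have N0 : (0 < N)%N by exact: ltnW.
have n0 : 0 < N%:R :> R by rewrite ltr0n.
have mg := @magn_itv R N k kN N0.
have /andP[k00 k0N] := k0_itv a m01 N1.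
have gk : gfun beta p (magn N k) - gfun beta p m <= - eta.
  case: (leP 0 (magn N k : R)) => s; first by have := sep _ fk; lra.
  move: mk; rewrite /mirror; case: (boolP (odd p)) => [op|ep] /=.
    by move=> _; have := @gfun_odd_le0 (magn N k) op ltac:(lra); have := eta_max; lra.
  rewrite /nearm -ltNge magn_sub// => fk'.
  by have := sep _ fk'; rewrite gfunN//; lra.
rewrite /qweight mulrC; apply: ler_pM; rewrite ?expR_ge0//.
- by apply: divr_ge0; exact/ltW/rho_gt0.
- rewrite exprS; apply: ler_pM; rewrite ?invr_ge0 ?(ltW (rho_gt0 _ _))//.
  + exact: rho_le.
  + by apply: rho_inv_le => //; exact: ltnW.
- by rewrite ler_expR mulrC -mulNr ler_wpM2r.
Qed.

Lemma sum_split N (A : nat -> bool) : (0 < N)%N ->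
  (~~ odd p -> forall k, (k <= N)%N -> A (N - k)%N = A k) ->
  \sum_(k < N.+1) (if A k then q N k else 0) =
  (1 + (~~ odd p)%:R) * (\sum_(k < N.+1) if near N k && A k then q N k else 0) +
  \sum_(k < N.+1) if far N k && A k then q N k else 0.
Proof.
move=> N0 Asym; have /andP[m0 m1] := m01.
have -> : (1 + (~~ odd p)%:R) * (\sum_(k < N.+1) if near N k && A k then q N k else 0) =
   \sum_(k < N.+1) (if near N k && A k then q N k else 0) +
   \sum_(k < N.+1) (if mirror N k && A k then q N k else 0).
  rewrite mulrDl mul1r; congr (_ + _); rewrite /mirror.
  case: (boolP (odd p)) => [op|ep] /=.
    by rewrite mul0r big1.
  rewrite mul1r (reindex_inj rev_ord_inj) /=; apply: eq_bigr => k _.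
  have kN : (k <= N)%N by rewrite -ltnS.
  by rewrite subSS Asym// qweightN.
rewrite -!big_split /=; apply: eq_bigr => k _; rewrite /far.
have kN : (k <= N)%N by rewrite -ltnS.
case: (A k); rewrite ?andbF ?andbT ?addr0//.
case: (boolP (near N k)) => nk; case: (boolP (mirror N k)) => mk /=; rewrite ?addr0 ?add0r//.
(* The wells are disjoint: as [d <= m / 2], one forces a positive magnetization and the other a
   negative one. *)
exfalso; move: nk mk; rewrite /mirror /nearm magn_sub// => nk /andP[_ mk].
by move: nk mk; rewrite !ler_norml => /andP[h1 h2] /andP[h3 h4]; have := dm; lra.
Qed.

Lemma poly_expR_cvg0 :
  N.+1%:R * ((expR 1 * N%:R) ^+ 3 * expR (- (eta * N%:R))) @[N --> \oo] --> (0 : R).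
Proof.
(* From [N + 1 <= 2 * N] and [expR x >= x ^+ 5 / 5!], the sequence is at most [C / N]. *)
pose C := 2 * expR 1 ^+ 3 * 120 / eta ^+ 5.
have e5 : 0 < eta ^+ 5 by rewrite exprn_gt0.
apply/cvgr0Pnorm_le => e e0.
have C0 : 0 < C by rewrite !mulr_gt0 ?invr_gt0 ?exprn_gt0 ?expR_gt0.
have := @cvgr_idn R => /cvgryPge /(_ (C / e)) hC; near=> N.
have N0 : (0 < N)%N by near: N; exact: nbhs_infty_gt.
have n0 : 0 < N%:R :> R by rewrite ltr0n.
have n1 : 1 <= N%:R :> R by rewrite ler1n.
have hN : C / e <= N%:R by near: N.
rewrite ger0_norm; last by rewrite !mulr_ge0 ?expR_ge0 ?exprn_ge0 ?mulr_ge0 ?expR_ge0.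
have ex : (eta * N%:R) ^+ 5 / 120 <= expR (eta * N%:R).
  have := @expR_ge1Dxn R (eta * N%:R) 4 (mulr_ge0 (ltW eta0) (ltW n0)).
  by rewrite (_ : 5`! = 120)%N //; lra.
have ey : 0 < (eta * N%:R) ^+ 5 / 120 by rewrite divr_gt0 ?exprn_gt0 ?mulr_gt0.
have einv : expR (- (eta * N%:R)) <= 120 / (eta * N%:R) ^+ 5.
  by rewrite expRN -[leRHS]invf_div lef_pV2// posrE expR_gt0.
apply: (@le_trans _ _ ((2 * N%:R) * ((expR 1 * N%:R) ^+ 3 * (120 / (eta * N%:R) ^+ 5)))).
  apply: ler_pM => //.
  - by rewrite -natr1; lra.
  - by rewrite ler_wpM2l ?exprn_ge0 ?mulr_ge0 ?expR_ge0.
rewrite (_ : _ * _ = C / N%:R); last first.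
  by rewrite /C; field; rewrite !gt_eqF.
by rewrite ler_pdivrMr// mulrC -ler_pdivrMr.
Unshelve. all: by end_near. Qed.

Lemma far_cvg0 (A : nat -> nat -> bool) :
  (a * rt N)^-1 * (\sum_(k < N.+1) if far N k && A N k then q N k else 0) @[N --> \oo] --> (0 : R).
Proof.
have h : a^-1 * (N.+1%:R * ((expR 1 * N%:R) ^+ 3 * expR (- (eta * N%:R)))) @[N --> \oo] --> (a^-1 * 0 : R).
  by apply: cvgM_seq; [exact: cvg_cst|exact: poly_expR_cvg0].
rewrite mulr0 in h.
apply: (squeeze_cvgr _ (cvg_cst 0) h); near=> N.
have N1 : (1 < N)%N by near: N; exact: nbhs_infty_gt.
have N0 : (0 < N)%N by exact: ltnW.
have n0 : 0 < N%:R :> R by rewrite ltr0n.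
have r0 : 0 < rt N by rewrite sqrtr_gt0.
have r1 : 1 <= rt N by rewrite -[X in X <= _]sqrtr1 ler_wsqrtr// ler1n.
have s0 : 0 <= \sum_(k < N.+1) if far N k && A N k then q N k else 0.
  by apply: sumr_ge0 => k _; case: ifP => // _; exact: qweight_ge0.
apply/andP; split; first by rewrite mulr_ge0// invr_ge0 mulr_ge0 ?ltW.
apply: ler_pM => //.
- by rewrite invr_ge0 mulr_ge0 ?ltW.
- by rewrite lef_pV2 ?posrE ?mulr_gt0// ler_peMr// ltW.
rewrite -[X in X%:R * _](card_ord N.+1) mulr_natl -sumr_const; apply: ler_sum => k _.
case: ifP => [/andP[fk _]|_]; first by apply: far_bound => //; rewrite -ltnS.
by rewrite mulr_ge0 ?exprn_ge0 ?mulr_ge0 ?expR_ge0.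
Unshelve. all: by end_near. Qed.

Hypothesis dm1 : d <= (1 - m) / 2.
Variables (G2 c : R).
Hypothesis taylor : little_o_at (gfun beta p) m (G2 / 2) 2.
Hypothesis c0 : 0 < c.
Hypothesis gc : forall h, `|h| <= d -> gfun beta p (m + h) - gfun beta p m <= - (c * h ^+ 2).
Variable v : R.
Hypothesis v0 : 0 < v.
Hypothesis vE : 2 * a ^+ 2 * G2 = - (2 * v)^-1.

(** The window around [m] gives the Laplace limit, its mirror image doubles it for even [p], and the
    far part vanishes. *)
Lemma scaled_sum_cvg (A : nat -> nat -> bool) (D : set R) (t0 : R) : measurable D ->
  (~~ odd p -> forall N k, (0 < N)%N -> (k <= N)%N -> A N (N - k)%N = A N k) ->
  (forall s, s != t0 ->
     \forall N \near \oo, A N (Num.truncn (lattice_index m a N s)) = (s \in D)) ->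
  (a * rt N)^-1 * (\sum_(k < N.+1) if A N k then q N k else 0) @[N --> \oo] -->
  (1 + (~~ odd p)%:R) * ((normal_peak (Num.sqrt v))^-1 * fine (normal_prob 0 (Num.sqrt v) D)).
Proof.
move=> mD Asym AD.
have dm' : d <= m by have /andP[? ?] := m01; have := dm; lra.
have := @laplace_limit R _ m a G2 d c m01 a0 taylor d0 dm' dm1 c0 gc A D t0 mD AD.
have -> : (\int[lebesgue_measure]_(s in D) (expR (2 * a ^+ 2 * G2 * s ^+ 2))%:E =
    ((normal_peak (Num.sqrt v))^-1 * fine (normal_prob 0 (Num.sqrt v) D))%:E)%E.
  rewrite -integral_gauss_normal//; apply: eq_integral => s _.
  by rewrite vE mulNr mulrC.
move=> /fine_cvg /= L.
have far0 := far_cvg0 A.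
have c1 : (fun _ : nat => 1 + (~~ odd p)%:R : R) n @[n --> \oo] --> (1 + (~~ odd p)%:R : R).
  exact: cvg_cst.
have := cvgD_seq (cvgM_seq c1 L) far0; rewrite addr0 => h.
apply: eq_cvg_near h; near=> N.
have N0 : (0 < N)%N by near: N; exact: nbhs_infty_gt.
rewrite (@sum_split N (A N))//; last by move=> ep k kN; exact: Asym.
by rewrite /= mulrDr; congr (_ + _); rewrite mulrCA.
Unshelve. all: by end_near. Qed.

Lemma gibbs_cvg (A : nat -> nat -> bool) (D : set R) (t0 : R) : measurable D ->
  (~~ odd p -> forall N k, (0 < N)%N -> (k <= N)%N -> A N (N - k)%N = A N k) ->
  (forall s, s != t0 ->
     \forall N \near \oo, A N (Num.truncn (lattice_index m a N s)) = (s \in D)) ->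
  gibbs_prob p beta (fun x : config N => A N (ups x)) @[N --> \oo] -->
  fine (normal_prob 0 (Num.sqrt v) D).
Proof.
move=> mD Asym AD.
have hA := scaled_sum_cvg mD Asym AD.
(* The same limit with the full event gives the normalization, so the well count and the Gaussian
   peak cancel in the quotient. *)
have hT : (a * rt N)^-1 * (\sum_(k < N.+1) q N k) @[N --> \oo] -->
    (1 + (~~ odd p)%:R) * (normal_peak (Num.sqrt v))^-1.
  have := @scaled_sum_cvg (fun _ _ => true) setT 0 measurableT (fun _ _ _ _ _ => erefl) _.
  rewrite probability_setT /= mulr1; apply => s _.
  by near=> N; rewrite in_setT.
have pk : 0 < normal_peak (Num.sqrt v) by apply: normal_peak_gt0; rewrite gt_eqF// sqrtr_gt0.
have C0 : (1 + (~~ odd p)%:R) * (normal_peak (Num.sqrt v))^-1 != 0 :> R.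
  have C1 : 0 < 1 + (~~ odd p)%:R :> R by apply: ltr_wpDr.
  by apply/lt0r_neq0/divr_gt0.
have hV : ((a * rt N)^-1 * (\sum_(k < N.+1) q N k))^-1 @[N --> \oo] -->
    ((1 + (~~ odd p)%:R) * (normal_peak (Num.sqrt v))^-1)^-1 by exact: cvgV.
have := cvgM_seq hA hV.
rewrite mulrA mulrAC divff// mul1r => h; apply: eq_cvg_near h.
near=> N.
have N0 : (0 < N)%N by near: N; exact: nbhs_infty_gt.
have r0 : 0 < a * rt N by rewrite mulr_gt0// sqrtr_gt0 ltr0n.
rewrite (@gibbs_probE R p beta m a N (A N))//; last by case: p p2.
by rewrite -mulf_div mulfV ?mul1r// invr_eq0 gt_eqF.
Unshelve. all: by end_near. Qed.

End Concentration.

(** * Delta method for the estimator *)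

Section CentralLimit.
Context {R : realType}.
Local Notation rt n := (Num.sqrt (n%:R : R)).
Variables (p : nat) (beta m : R).
Hypothesis p2 : (2 <= p)%N.
Hypothesis beta0 : 0 <= beta.
Hypothesis m01 : 0 < m < 1.
Hypothesis gm0 : 0 < gfun beta p m.
Hypothesis gmax : forall t, 0 <= t <= 1 -> gfun beta p t <= gfun beta p m.

Let dphi := - gfun'' p beta m / (p%:R * m ^+ p.-1).

Lemma phi_scaled_cvg (a s : R) :
  rt N * (phi p (magn N (Num.truncn (lattice_index m a N s))) - beta) @[N --> \oo] -->
  2 * a * dphi * s.
Proof.
have g'0 := gfun'_max m01 gmax.
have /andP[m0 m1] := m01.
have der := is_derive_phi_critical p2 m01 g'0.
have := taylor_scaled (is_derive_approx der) (@magn_index_cvg R m a m01 s).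
rewrite (phi_critical p2 m0 g'0) -/dphi (_ : dphi * _ ^+ 1 = 2 * a * dphi * s); last by ring.
by move=> h; apply: eq_cvg_near h; near=> N; rewrite addrCA subrr addr0 expr1.
Unshelve. all: by end_near. Qed.

(** The rescaled estimator tends to [s], so for [s != t] its comparison with [t] is eventually
    settled. *)
Lemma mplm_event (a s t : R) :
  2 * a * dphi = 1 -> s != t ->
  \forall N \near \oo,
    ((rt N)%:E * (mplm p (magn N (Num.truncn (lattice_index m a N s))) - beta%:E) <= t%:E)%E =
    (s \in `]-oo, t]%classic).
Proof.
move=> ad st; have /andP[m0 m1] := m01.
have hphi := @phi_scaled_cvg a s; rewrite ad mul1r in hphi.
have hm := cvg_sub0_seq (sqrtn_scaled_cvg0 (@magn_index_cvg R m a m01 s)).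
have h0 : \forall N \near \oo, 0 < (magn N (Num.truncn (lattice_index m a N s)) : R).
  exact: (cvgr_gt _ hm).
have h1 : \forall N \near \oo, (magn N (Num.truncn (lattice_index m a N s)) : R) < 1.
  exact: (cvgr_lt _ hm).
rewrite mem_setE in_itv /=.
case: (ltgtP s t) st => // lt _.
- have h2 : \forall N \near \oo, rt N * (phi p (magn N (Num.truncn (lattice_index m a N s))) - beta) <= t.
    exact: (cvgr_le _ hphi).
  near=> N; rewrite mplm_phi//; last by apply/andP; split; near: N.
  by rewrite -EFinB -EFinM lee_fin; near: N; apply: filterS h2.
- have h2 : \forall N \near \oo, t < rt N * (phi p (magn N (Num.truncn (lattice_index m a N s))) - beta).
    exact: (cvgr_gt _ hphi).
  near=> N; rewrite mplm_phi//; last by apply/andP; split; near: N.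
  rewrite -EFinB -EFinM lee_fin; apply/negbTE; rewrite -ltNge.
  by near: N.
Unshelve. all: by end_near. Qed.

Lemma mpl_central_limit (t : R) (v := - gfun'' p beta m / (p%:R ^+ 2 * m ^+ (2 * p - 2))) :
  0 < v /\
  gibbs_prob p beta (fun x : config N => ((rt N)%:E * (mpl R p x - beta%:E) <= t%:E)%E)
    @[N --> \oo] --> fine (normal_prob 0 (Num.sqrt v) `]-oo, t]).
Proof.
have /andP[m0 m1] := m01.
have g'0 := gfun'_max m01 gmax.
have G20 := gfun''_lt0 p2 m01 g'0 gm0.
set G2 := gfun'' p beta m in v G20 *.
have G2n : G2 != 0 by rewrite lt_eqF.
have pp : 0 < p%:R :> R by rewrite ltr0n; case: p p2.
have mp : 0 < m ^+ p.-1 by rewrite exprn_gt0.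
have dphi0 : 0 < dphi by rewrite divr_gt0 ?mulr_gt0// oppr_gt0.
(* The squared slope of [phi] times [-1 / G2], the Gaussian variance of the rescaled magnetization
   within a well. *)
have vE : v = dphi ^+ 2 / - G2.
  rewrite /v /dphi -/G2 (_ : (2 * p - 2 = p.-1 * 2)%N); last by rewrite -subn1 mulnBl mul1n mulnC.
  by rewrite exprM; field; rewrite G2n !gt_eqF.
have v0 : 0 < v by rewrite vE divr_gt0 ?exprn_gt0// oppr_gt0.
split => //.
(* This scale makes [s] the limit of the rescaled estimator itself, so the limiting event is
   [s <= t]. *)
pose a := (2 * dphi)^-1.
have a0 : 0 < a by rewrite invr_gt0 mulr_gt0.
have aE : 2 * a ^+ 2 * G2 = - (2 * v)^-1.
  by rewrite vE /a; field; rewrite G2n gt_eqF.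
have ad : 2 * a * dphi = 1 by rewrite /a; field; rewrite gt_eqF.
have taylor : little_o_at (gfun beta p) m (G2 / 2) 2 by apply: gfun_taylor => //; lra.
(* Half of the quadratic coefficient is given up to absorb the Taylor remainder. *)
have c0 : 0 < - G2 / 4 by rewrite divr_gt0// oppr_gt0.
have [d1 d10 hd1] := taylor _ c0.
pose d := Num.min d1 (Num.min (m / 2) ((1 - m) / 2)).
have [d0 dd1 dm dm1] : [/\ 0 < d, d <= d1, d <= m / 2 & d <= (1 - m) / 2].
  by split; rewrite /d ?lt_min ?ge_min ?lexx ?orbT// d10 !divr_gt0//; lra.
have gc h : `|h| <= d -> gfun beta p (m + h) - gfun beta p m <= - (- G2 / 4 * h ^+ 2).
  move=> hd; have := hd1 h (le_trans hd dd1).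
  by rewrite real_normK ?num_real// ler_norml => /andP[_]; lra.
have [e e0 he] := gfun_separation p2 beta0 m01 gm0 gmax d0.
(* The cap at [g m] handles negative magnetizations for odd [p], where only [g <= 0] is known. *)
pose eta := Num.min e (gfun beta p m).
have [eta0 ee eg] : [/\ 0 < eta, eta <= e & eta <= gfun beta p m].
  by split; rewrite /eta ?lt_min ?ge_min ?lexx ?orbT// e0.
have sep s : 0 <= s <= 1 -> d < `|s - m| -> gfun beta p s <= gfun beta p m - eta.
  by move=> hs ds; have := he s hs ds; lra.
pose A N k := ((rt N)%:E * (mplm p (magn N k) - beta%:E) <= t%:E)%E.
have Asym : ~~ odd p -> forall N k, (0 < N)%N -> (k <= N)%N -> A N (N - k)%N = A N k.
  move=> ep N k N0 kN; rewrite /A (magn_sub kN N0) (_ : mplm p _ = mplm p (magn N k)) //.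
  by apply: mplmN => //; exact: ltnW.
have := @gibbs_cvg R p beta m a d eta p2 beta0 m01 a0 d0 dm eta0 eg sep dm1 G2 _
  taylor c0 gc v v0 aE A `]-oo, t]%classic t (measurable_itv _) Asym (fun s => mplm_event ad).
move=> h; apply: eq_cvg_near h; near=> N.
have N0 : (0 < N)%N by near: N; exact: nbhs_infty_gt.
congr (gibbs_prob _ _ _); apply/funext => x; rewrite /A mpl_magn//.
by case: p p2.
Unshelve. all: by end_near. Qed.

End CentralLimit.

(** * Assembly: maximizer, uniqueness and limit law *)

Unset Implicit Arguments.

Theorem mainTheorem17 (R : realType) (p : nat) (beta : R) :
  (2 <= p)%N -> (betaCW R p < beta%:E)%E ->
  exists m : R,
    [/\ pos_global_max beta p m,
        (forall m' : R, pos_global_max beta p m' -> m' = m) &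
        cvg_in_dist_gibbs p beta
          (fun N x => ((Num.sqrt (N%:R : R))%:E * (mpl R p x - beta%:E))%E)
          (normal_cdf
             (- (derive1 (derive1 (gfun beta p)) m) /
              ((p%:R) ^+ 2 * m ^+ (2 * p - 2))))].
Proof.
move=> p2 hlt.
have [beta0 [t1 ht1 gt1]] := betaCW_lt p2 hlt.
have [m [m01 gm gmax]] := gfun_max_exists p2 beta0 ht1 gt1.
have /andP[m0 m1] := m01.
have gmax01 t : 0 <= t <= 1 -> gfun beta p t <= gfun beta p m.
  by move=> ht; apply: gmax; lra.
exists m; split.
- split=> //; split; first by rewrite in_itv/=; lra.
  by move=> t; rewrite in_itv/=; exact: gmax.
- move=> m' [m'0 []]; rewrite in_itv/= => hm' m'max.
  apply: (gfun_max_unique p2 beta0 gm m01 _ gmax01); first by lra.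
  apply/eqP; rewrite eq_le gmax//= m'max// in_itv/=; lra.
- move=> t _.
  have [v0 h] := mpl_central_limit p2 beta0 m01 gm gmax01 t.
  (* Positivity of the variance selects the nondegenerate branch of [normal_cdf]. *)
  by rewrite derive1_derive1_gfun ?/normal_cdf ?v0//; lra.
Qed.
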